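(* Fix $m\in\mathbb N$ and $\mathbf y\in\mathbb R^m$. If the statement $\mathrm{IDSC}(1,m,\mathbf y)$ holds, then $\mathrm{IDSC}(n,m,\mathbf y)$ holds for all $n\ge1$.
   Context: $\varphi$ is Euler's totient function, $\mathbb R_+$ the nonnegative reals, $|\cdot|$ the maximum norm, $B(\mathbf 0,r)$ the ball of radius $r$ in it; for nonzero $\mathbf q\in\mathbb Z^n$, $\gcd(\mathbf q)$ is the gcd of its entries. For $n\in\mathbb N$ and nonzero $\mathbf q\in\mathbb Z^n$ let $P(\mathbf q)=\{\mathbf p+\mathbf y:\mathbf p=(p_1,\dots,p_m)\in\mathbb Z^m,\ \gcd(p_i,q_1,\dots,q_n)=1\text{ for }i=1,\dots,m\}$. For $\psi:\mathbb Z^n\to\mathbb R_+$, $W_{n,m}^P(\psi)$ is the set of $\mathbf X\in\mathbb T^{nm}=M_{n\times m}(\mathbb R)/M_{n\times m}(\mathbb Z)$ such that $\mathbf q\mathbf X\in B(\mathbf 0,\psi(\mathbf q))+P(\mathbf q)$ for infinitely many $\mathbf q\in\mathbb Z^n$ ($\mathbf q$ a row vector). We say $\mathrm{IDSC}(n,m,\mathbf y)$ holds if for every $\psi:\mathbb Z^n\to\mathbb R_+$, $\mathrm{Leb}(W_{n,m}^P(\psi))=0$ when $\sum_{\mathbf q\in\mathbb Z^n\setminus\{\mathbf 0\}}\big(\varphi(\gcd(\mathbf q))\psi(\mathbf q)/\gcd(\mathbf q)\big)^m<\infty$ and $\mathrm{Leb}(W_{n,m}^P(\psi))=1$ when this series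 diverges. *)

(* Defs.v *)
From HB Require Import structures.
From mathcomp Require Import all_boot all_order all_algebra.
From mathcomp Require Import all_classical all_reals all_analysis.

Set Implicit Arguments.
Unset Strict Implicit.
Unset Printing Implicit Defensive.

Import Order.TTheory GRing.Theory Num.Theory.
Import numFieldNormedType.Exports.

Local Open Scope classical_set_scope.
Local Open Scope ring_scope.
Local Open Scope quotient_scope.

Section Torus.
Context (R : realType) (n m : nat).

Definition torus_rel : rel 'M[R]_(n, m) :=
  fun X Y => X - Y \is a mxOver Num.int.

Lemma torus_rel_refl : reflexive torus_rel.
Proof. by move=> X; apply/mxOverP => i j; rewrite !mxE subrr rpred0. Qed.

Lemma torus_rel_sym : symmetric torus_rel.
Proof.
by move=> X Y; apply/mxOverP/mxOverP => XY i j; move: (XY i j);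
  rewrite !mxE -opprB rpredN.
Qed.

Lemma torus_rel_trans : transitive torus_rel.
Proof.
move=> Y X Z /mxOverP XY /mxOverP YZ; apply/mxOverP => i j.
by have := rpredD (XY i j) (YZ i j); rewrite !mxE addrA subrK.
Qed.

Canonical torus_equiv :=
  EquivRel torus_rel torus_rel_refl torus_rel_sym torus_rel_trans.

Definition torus : Type := {eq_quot torus_equiv}.

HB.instance Definition _ := Choice.on torus.
HB.instance Definition _ := EqQuotient.on torus.
HB.instance Definition _ := isPointed.Build torus (\pi_torus 0).

Lemma torusP (X Y : 'M[R]_(n, m)) :
  reflect (\pi_torus X = \pi_torus Y) (X - Y \is a mxOver Num.int).
Proof. by apply: (iffP idP) => [XY|/eqmodP//]; apply/eqmodP. Qed.

Definition torus_of_tuple (t : (n * m).-tuple (measurableTypeR R)) : torus :=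
  \pi_torus (vec_mx (\row_k (tnth t k : R))).

(* The Borel sets of the torus: those with Borel preimage in R^(nm). *)
Let torus_measurable : set (set torus) :=
  image_set_system setT torus_of_tuple measurable.

Let torus_sigma_algebra : sigma_algebra setT torus_measurable.
Proof. exact/sigma_algebra_image/sigma_algebra_measurable. Qed.

Let torus_measurable0 : torus_measurable set0.
Proof. by case: torus_sigma_algebra. Qed.

Let torus_measurableC A : torus_measurable A -> torus_measurable (~` A).
Proof. by case: torus_sigma_algebra => _ + _ => /[apply]; rewrite setTD. Qed.

Let torus_measurable_bigcup (F : (set torus)^nat) :
  (forall i, torus_measurable (F i)) -> torus_measurable (\bigcup_i F i).
Proof. by case: torus_sigma_algebra => _ _; exact. Qed.

HB.instance Definition _ := @isMeasurable.Build default_measure_display torus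
  torus_measurable torus_measurable0 torus_measurableC torus_measurable_bigcup.

Lemma measurable_torus_of_tuple : measurable_fun setT torus_of_tuple.
Proof. by move=> _ A. Qed.

HB.instance Definition _ := @isMeasurableFun.Build _ _ _ _
  torus_of_tuple measurable_torus_of_tuple.

End Torus.

Section LebesgueTorus.
Context (R : realType).

Definition lebesgue01 : set (measurableTypeR R) -> \bar R :=
  mrestr lebesgue_measure (measurable_itv `[0%R, 1%R[).

HB.instance Definition _ := Measure.on lebesgue01.

Let lebesgue01_setT : lebesgue01 setT = 1%E.
Proof.
rewrite /lebesgue01 /mrestr setTI lebesgue_measure_itv /=.
by rewrite lte_fin ltr01 oppr0 adde0.
Qed.

HB.instance Definition _ :=
  Measure_isProbability.Build _ _ _ lebesgue01 lebesgue01_setT.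

Definition tuple_cons k (p : measurableTypeR R * k.-tuple (measurableTypeR R)) :
    k.+1.-tuple (measurableTypeR R) :=
  [tuple of p.1 :: p.2].

Lemma measurable_tuple_cons k : measurable_fun setT (@tuple_cons k).
Proof. exact: measurable_cons. Qed.

HB.instance Definition _ k := @isMeasurableFun.Build _ _ _ _
  (@tuple_cons k) (@measurable_tuple_cons k).

(* Lebesgue measure on R^k, restricted to the unit cube [0, 1)^k. *)
Fixpoint lebesgue_cube k : probability (k.-tuple (measurableTypeR R)) R :=
  if k is k'.+1
  then distribution (lebesgue01 \x lebesgue_cube k')%E (@tuple_cons k')
  else \d_([tuple] : 0.-tuple (measurableTypeR R)).

Definition lebesgue_torus n m : probability (torus R n m) R :=
  distribution (lebesgue_cube (n * m)) (@torus_of_tuple R n m).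

End LebesgueTorus.

Section IDSC.
Context (R : realType) (n m : nat).
Implicit Types (q : 'rV[int]_n) (y : 'rV[R]_m) (psi : 'rV[int]_n -> R).

Definition gcd_row q : nat := \big[gcdn/0%N]_(j < n) `|q ord0 j|%N.

Definition Pset y q : set 'rV[R]_m :=
  [set map_mx intr p + y | p in
    [set p : 'rV[int]_m | forall i, gcdn `|p ord0 i|%N (gcd_row q) = 1%N]].

(* The condition on a representative X of a point of the torus; it only depends
   on the class of X, see WsetP. The ball is the open one. *)
Definition approximable y psi q (X : 'M[R]_(n, m)) : Prop :=
  [set b + c | b in ball (0 : 'rV[R]_m) (psi q) & c in Pset y q]
    (map_mx intr q *m X).

(* Pset is only meant for q != 0, and a single q does not matter here. *)
Definition Wset y psi : set (torus R n m) :=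
  [set \pi_(torus R n m) X | X in
    [set X | infinite_set [set q | q != 0 /\ approximable y psi q X]]].

Lemma gcd_row_mulmx q (Z : 'M[int]_(n, m)) i :
  ((gcd_row q : int) %| (q *m Z) ord0 i)%Z.
Proof.
rewrite mxE; apply: rpred_sum => j _; apply: dvdz_mulr.
by rewrite dvdzE /= /gcd_row (bigD1 j) //= dvdn_gcdl.
Qed.

Lemma approximable_shift y psi q (X : 'M[R]_(n, m)) (Z : 'M[int]_(n, m)) :
  approximable y psi q X -> approximable y psi q (X + map_mx intr Z).
Proof.
case=> b bB [_ [p pP <-]] bpX; exists b => //.
exists (map_mx intr (p + q *m Z) + y).
  exists (p + q *m Z) => //= i; rewrite -[RHS](pP i) mxE.
  have /dvdzP[k ->] := gcd_row_mulmx q Z i.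
  rewrite addrC gcdnC [RHS]gcdnC.
  by have [] := gcdzMDl k (gcd_row q) (p ord0 i).
by rewrite mulmxDr -bpX -map_mxM map_mxD addrAC !addrA.
Qed.

Lemma WsetP y psi (X : 'M[R]_(n, m)) :
  Wset y psi (\pi_(torus R n m) X) <->
  infinite_set [set q | q != 0 /\ approximable y psi q X].
Proof.
split=> [[X' + /torusP]|]; last by move=> WX; exists X.
have shift (U V : 'M[R]_(n, m)) : U - V \is a mxOver Num.int ->
    exists Z : 'M[int]_(n, m), U = V + map_mx intr Z.
  move=> /mxOverP UV; exists (map_mx (@Num.floor R) (U - V)).
  apply/matrixP => i j; have := UV i j; rewrite !mxE => /floorK ->.
  by rewrite addrC subrK.
move=> + /shift[Z X'E]; rewrite X'E; apply: contra_not.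
apply: sub_finite_set => q [q0 aq]; split=> //.
have := approximable_shift (- Z) aq.
by rewrite map_mxN -addrA subrr addr0.
Qed.

Definition idsc_series psi : \bar R :=
  \esum_(q in [set q | q != 0])
    (((totient (gcd_row q))%:R * psi q / (gcd_row q)%:R) ^+ m)%:E.

Definition IDSC y : Prop :=
  forall psi, (forall q, 0 <= psi q) ->
    ((idsc_series psi < +oo)%E -> lebesgue_torus R n m (Wset y psi) = 0%E) /\
    (idsc_series psi = +oo%E -> lebesgue_torus R n m (Wset y psi) = 1%E).

End IDSC.
Arguments IDSC {R} n m y.

(* Main.v *)
Require Import Defs.
From HB Require Import structures.
From mathcomp Require Import all_boot all_order all_algebra.
From mathcomp Require Import all_classical all_reals all_analysis.
From mathcomp Require Import measurable_realfun.
From mathcomp Require Import zify ring lra.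

(* Write a nonzero q as d v with v primitive, chosen once up to sign, so that
   approximation of X by q is approximation of v X by d. The maps X |-> v X carry
   Haar measure on T^(nm) to Haar measure on T^m, and for different lines they
   are pairwise independent. The convergence half is the Borel-Cantelli lemma.
   For divergence, either some line carries a divergent series, and IDSC 1 applies
   to it, or the events "v X is approximable at some d" have divergent total
   measure, and the second Borel-Cantelli lemma for pairwise independent events
   applies. The total measure diverges because otherwise truncations of the
   restrictions of psi to the lines could be moved to disjoint sets of integers,
   by scaling with distinct large primes, producing a single psi on Z that
   contradicts IDSC 1. *)

Set Implicit Arguments.
Unset Strict Implicit.
Unset Printing Implicit Defensive.

Import Order.TTheory GRing.Theory Num.Theory.
Import numFieldNormedType.Exports.

Local Open Scope classical_set_scope.
Local Open Scope ring_scope.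

(** * Translation invariance of Haar measure *)

(** The second Borel-Cantelli lemma cannot be applied to the events at individual [q]: for multiples
    of one [v] these may be strongly correlated, and such overlaps are the difficulty of the case n
    = 1. Hence each line contributes a single event, and overlaps within a line are only handled
    through IDSC 1. Representatives of two different lines are linearly independent, so X |-> (v X,
    w X) is onto; this gives independence of pairs but not of triples, since three vectors may be
    dependent. The truncations are finite for two reasons. A prime can then exceed all their
    entries, which keeps the scaled copies disjoint and costs at most a factor 2 in phi(g)/g.
    Moreover one copy supplies only finitely many q, so infinitely many q force infinitely many
    copies. *)

Section OneDimensional.
Context (R : realType).
Implicit Types (c : R) (g : measurableTypeR R -> \bar R).
Local Notation mu := (@lebesgue_measure R).
Local Open Scope ereal_scope.

Lemma measurable_addr c :
  measurable_fun setT ((fun x => x + c)%R : measurableTypeR R -> measurableTypeR R).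
Proof. exact: measurable_funD. Qed.

Lemma preimage_addr_itv c (b1 b2 : bool) (x y : R) :
  (fun z => z + c)%R @^-1` [set` Interval (BSide b1 x) (BSide b2 y)] =
  [set` Interval (BSide b1 (x - c)) (BSide b2 (y - c))]%R.
Proof.
apply/seteqP; split => z /=; rewrite !in_itv /= => /andP[xz zy];
  apply/andP; split; case: b1 b2 xz zy => [] [] /= xz zy; lra.
Qed.

(** A translation keeps the length of half-open intervals, and these lengths determine Lebesgue
    measure. *)
Lemma lebesgue_measure_addr c (A : set (measurableTypeR R)) : measurable A ->
  pushforward mu ((fun x => x + c)%R : measurableTypeR R -> measurableTypeR R) A
    = mu A.
Proof.
move=> mA.
pose H := isMeasurableFun.Build _ _ _ _ _ (measurable_addr c).
pose f : {mfun measurableTypeR R >-> measurableTypeR R} :=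
  HB.pack ((fun x => x + c)%R : measurableTypeR R -> measurableTypeR R) H.
apply/esym; apply: (lebesgue_measure_unique (mu := pushforward mu f)) => //= _ [[a b]] _ <-.
rewrite /pushforward preimage_addr_itv/= !lebesgue_measure_itv/= !lte_fin.
by rewrite ltrD2r -!EFinB (_ : b - c - (a - c) = b - a)%R//; ring.
Qed.

Lemma ge0_integral_addr c g (D : set (measurableTypeR R)) : measurable D ->
  measurable_fun setT g -> (forall x, 0 <= g x) ->
  \int[mu]_(x in (fun x => x + c)%R @^-1` D) g (x + c)%R = \int[mu]_(x in D) g x.
Proof.
move=> mD mg g0.
rewrite -(ge0_integral_pushforward (measurable_addr c))//; last exact: measurable_funS mg.
apply: eq_measure_integral; first exact: measurable_addr.
by move=> mf A mA _; exact: lebesgue_measure_addr.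
Qed.

Lemma integral_lebesgue01 g : measurable_fun setT g -> (forall x, 0 <= g x) ->
  \int[@lebesgue01 R]_x g x = \int[mu]_(x in `[0%R, 1%R[) g x.
Proof.
move=> mg g0; set I : set (measurableTypeR R) := `[0%R, 1%R[%classic.
have mI : measurable I by exact: measurable_itv.
rewrite -(setvU I) ge0_integral_setU//; last 3 first.
- exact: measurableC.
- by apply: measurable_funS mg.
- by rewrite disj_set2E setICl.
(* [lebesgue01] is a measure on the whole line that vanishes outside [0, 1), so on the complement it
   agrees with the zero measure. *)
rewrite (@eq_measure_integral _ _ _ _ mzero)/=; last first.
  move=> A mA AI; rewrite /lebesgue01 /mrestr/= (_ : A `&` _ = set0) ?measure0//.
  by rewrite -subset0 => x [/AI].
rewrite integral_measure_zero add0e; apply: eq_measure_integral => A mA AI.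
by rewrite /lebesgue01 /mrestr/=; congr mu; apply/setIidPl.
Qed.

(** Periodicity reduces c to its fractional part. The shifted integral then runs over [c, 1 + c);
    cut at 1, its second piece moves back to [0, c). *)
Lemma lebesgue01_periodic_addr c g : measurable_fun setT g ->
  (forall x, 0 <= g x) -> (forall x, g (x + 1)%R = g x) ->
  \int[@lebesgue01 R]_x g (x + c)%R = \int[@lebesgue01 R]_x g x.
Proof.
move=> mg g0 g1.
have gZ (k : int) x : g (x + k%:~R)%R = g x.
  have gn (n : nat) z : g (z + n%:R)%R = g z.
    by elim: n => [|n IH]; rewrite ?addr0// -natr1 addrA g1.
  case: k => n; first by rewrite -pmulrn gn.
  by rewrite NegzE mulrNz -(gn n.+1 (x - _)%R) -pmulrn subrK.
have mga (a : R) : measurable_fun setT (fun x : measurableTypeR R => g (x + a)%R).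
  exact: (measurableT_comp mg (measurable_addr a)).
wlog c01 : c / (0 <= c < 1)%R => [wl|].
  have -> : (fun x : R => g (x + c)%R) = (fun x => g (x + (c - (Num.floor c)%:~R))%R).
    by apply/funext => x; rewrite -[RHS](gZ (Num.floor c)) -addrA subrK.
  apply: wl; have := floor_itv c.
  by rewrite intrD => /andP[h1 h2]; rewrite subr_ge0 h1 ltrBlDl.
have /andP[c0 c1] := c01.
rewrite !integral_lebesgue01//.
have := ge0_integral_addr c (D := `[c, (1 + c)%R[%classic) (measurable_itv _) mg g0.
rewrite preimage_addr_itv subrr addrK => ->.
rewrite (itv_bndbnd_setU (x := BLeft 1%R)) ?bnd_simp ?lerDl//; last exact/ltW.
rewrite ge0_integral_setU//; last 2 first.
- exact: measurable_funS mg.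
- by rewrite disj_set2E; apply/eqP; rewrite -subset0 => x [/=]; rewrite !in_itv/=; lra.
have -> : \int[mu]_(x in `[1%R, (1 + c)%R[) g x = \int[mu]_(x in `[0%R, c[) g x.
  rewrite -(ge0_integral_addr 1)// preimage_addr_itv subrr addrAC subrr add0r.
  by apply: eq_integral => x _; rewrite g1.
rewrite addeC [in RHS](itv_bndbnd_setU (x := BLeft c)) ?bnd_simp//; last exact/ltW.
rewrite ge0_integral_setU//.
- exact: measurable_funS mg.
- by rewrite disj_set2E; apply/eqP; rewrite -subset0 => x [/=]; rewrite !in_itv/=; lra.
Qed.

End OneDimensional.

Section Cube.
Context (R : realType).
Local Notation tup k := (k.-tuple (measurableTypeR R)).

Definition tuple_addr k (c : 'I_k -> R) (t : tup k) : tup k :=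
  [tuple (tnth t i : R) + c i | i < k].

Lemma lebesgue_cubeS k (A : set (tup k.+1)) :
  lebesgue_cube R k.+1 A =
  (\int[@lebesgue01 R]_x lebesgue_cube R k [set t : tup k | A [tuple of x :: t]])%E.
Proof.
rewrite /= /distribution /pushforward/= /product_measure1.
apply: eq_integral => x _ /=; congr (lebesgue_cube R k _).
by apply/seteqP; split => t; rewrite /xsection/= inE.
Qed.

Lemma measurable_cons_section k (A : set (tup k.+1)) (x : R) :
  measurable A -> measurable [set t : tup k | A [tuple of x :: t]].
Proof.
move=> mA; rewrite -[X in measurable X]setTI.
exact: (measurable_cons (f := fun=> x : measurableTypeR R) (g := id)).
Qed.

Lemma measurable_fun_cube_section k (A : set (tup k.+1)) : measurable A ->
  measurable_fun setT (fun x : measurableTypeR R =>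
    lebesgue_cube R k [set t : tup k | A [tuple of x :: t]]).
Proof.
move=> mA.
have mB : measurable (@tuple_cons R k @^-1` A).
  by rewrite -[X in measurable X]setTI; exact: measurable_tuple_cons.
rewrite (_ : (fun _ => _) = lebesgue_cube R k \o xsection (@tuple_cons R k @^-1` A)).
  exact: measurable_fun_xsection.
apply/funext => x /=; congr (lebesgue_cube R k _).
by apply/seteqP; split => t; rewrite /xsection/= inE.
Qed.

Lemma tuple_addr_cons k (c : 'I_k.+1 -> R) (x : R) (t : tup k) :
  tuple_addr c [tuple of (x : measurableTypeR R) :: t] =
  [tuple of (x + c ord0 : measurableTypeR R) :: tuple_addr (c \o lift ord0) t].
Proof.
apply: eq_from_tnth => i; rewrite tnth_mktuple.
by case: (unliftP ord0 i) => [j ->|->]; rewrite ?tnthS ?tnth_mktuple ?tnth0.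
Qed.

(** Induction on the dimension: sections of a periodic set are periodic, so the other coordinates
    can be shifted inside each section, and the measure of the section is a 1-periodic function of
    the first coordinate. *)
Lemma lebesgue_cube_addr k (c : 'I_k -> R) (A : set (tup k)) : measurable A ->
  (forall t (z : 'I_k -> int), A (tuple_addr (fun i => (z i)%:~R) t) <-> A t) ->
  lebesgue_cube R k (tuple_addr c @^-1` A) = lebesgue_cube R k A.
Proof.
elim: k c A => [|k IH] c A mA pA.
  congr (lebesgue_cube R 0 _); apply/seteqP.
  by split => t /=; rewrite (tuple0 (tuple_addr _ _)) (tuple0 t).
rewrite !lebesgue_cubeS.
have p0 : measurable_fun setT (fun x : measurableTypeR R =>
    lebesgue_cube R k [set t : tup k | A [tuple of x :: t]]).
  exact: measurable_fun_cube_section.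
rewrite -(lebesgue01_periodic_addr (c ord0) p0)//.
- apply: eq_integral => x _.
  rewrite -[RHS](IH (c \o lift ord0)).
  + congr (lebesgue_cube R k _); apply/seteqP.
    by split => t /=; rewrite tuple_addr_cons.
  + exact: measurable_cons_section.
  + move=> t z /=.
    (* An integer shift of the section is one of [A] with 0 in the first coordinate. *)
    apply: iff_sym; apply: iff_trans (iff_sym (pA _
      (fun i => if unlift ord0 i is Some j then z j else 0))) _.
    rewrite tuple_addr_cons unlift_none addr0.
    rewrite (_ : (fun i : 'I_k.+1 => _) \o _ = fun i => (z i)%:~R)//.
    by apply/funext => i /=; rewrite liftK.
- move=> x; congr (lebesgue_cube R k _); apply/seteqP.
  suff E (t : tup k) : A [tuple of (x + 1 : measurableTypeR R) :: t] <->
      A [tuple of (x : measurableTypeR R) :: t] by split=> t /E.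
  rewrite -(pA [tuple of x :: t] (fun i => if unlift ord0 i is Some j then 0 else 1)).
  rewrite tuple_addr_cons unlift_none (_ : tuple_addr _ t = t)//.
  by apply: eq_from_tnth => i; rewrite tnth_mktuple/= liftK addr0.
Qed.

End Cube.

(** * Fubini's theorem for sets with constant sections *)

Section Fubini.
Context d1 d2 (T1 : measurableType d1) (T2 : measurableType d2) (R : realType).
Local Open Scope ereal_scope.

(** Both constants are the product measure of [B], computed in the two orders of integration. This
    is the tool for comparing the measure of a set with that of its preimage under a linear map. *)
Lemma probability_const_sections (P : probability T1 R) (Q : probability T2 R)
    (B : set (T1 * T2)) (a b : \bar R) : measurable B ->
  (forall x, Q (xsection B x) = a) -> (forall y, P (ysection B y) = b) -> a = b.
Proof.
move=> mB Qa Pb.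
have : (P \x Q) B = (P \x^ Q) B.
  by apply: product_measure_unique => // *; exact: product_measure2E.
rewrite /product_measure1 /product_measure2.
under eq_integral do rewrite /= Qa.
under [RHS]eq_integral do rewrite /= Pb.
by rewrite !integral_cst//= (probability_setT P) (probability_setT Q) !mule1.
Qed.

End Fubini.

Section Haar.
Context (R : realType).
Local Notation tup k := (k.-tuple (measurableTypeR R)).

Definition mx_of_tuple n m (t : tup (n * m)) : 'M[R]_(n, m) :=
  vec_mx (\row_k (tnth t k : R)).

Definition mx_measurable n m (S : set 'M[R]_(n, m)) :=
  measurable (@mx_of_tuple n m @^-1` S).

Definition mx_periodic n m (S : set 'M[R]_(n, m)) :=
  forall X (Z : 'M[int]_(n, m)), S X -> S (X + map_mx intr Z).

(** For periodic [S] this is Haar measure of the image of [S] in the torus, read off on the unit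
    cube; working with periodic sets of matrices avoids quotients. *)
Definition haar n m (S : set 'M[R]_(n, m)) : \bar R :=
  lebesgue_cube R (n * m) (@mx_of_tuple n m @^-1` S).

Lemma mx_periodicE n m (S : set 'M[R]_(n, m)) : mx_periodic S ->
  forall X (Z : 'M[int]_(n, m)), S (X + map_mx intr Z) <-> S X.
Proof.
move=> pS X Z; split=> [/(@pS _ (- Z))|]; last exact: pS.
by rewrite map_mxN addrK.
Qed.

Lemma mx_measurable_preimage d (T : measurableType d) n m
    (phi : T -> 'M[R]_(n, m)) (S : set 'M[R]_(n, m)) :
  (forall i j, measurable_fun setT (fun x => phi x i j : measurableTypeR R)) ->
  mx_measurable S -> measurable (phi @^-1` S).
Proof.
move=> mphi mS.
pose f x : tup (n * m) := [tuple mxvec (phi x) ord0 k | k < n * m].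
have fE : phi = @mx_of_tuple n m \o f.
  apply/funext => x; rewrite /mx_of_tuple/= -[LHS]mxvecK; congr vec_mx.
  by apply/rowP => k; rewrite mxE tnth_mktuple.
have mf : measurable_fun setT f.
  apply/measurable_fun_tnthP => k.
  case/mxvec_indexP: k => i j.
  rewrite (_ : _ \o _ = fun x => phi x i j : measurableTypeR R)//.
  by apply/funext => x /=; rewrite tnth_mktuple mxvecE.
by rewrite fE comp_preimage -[X in measurable X]setTI; exact: mf.
Qed.

Lemma mx_of_tupleE n m (t : tup (n * m)) i j :
  mx_of_tuple t i j = tnth t (mxvec_index i j).
Proof. by rewrite /mx_of_tuple !mxE. Qed.

Lemma measurable_mx_of_tuple n m i j :
  measurable_fun setT
    (fun t : tup (n * m) => mx_of_tuple t i j : measurableTypeR R).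
Proof.
rewrite (_ : (fun t => _) = fun t => tnth t (mxvec_index i j)).
  exact: measurable_tnth.
by apply/funext => t; rewrite mx_of_tupleE.
Qed.

Lemma haar_addr n m (S : set 'M[R]_(n, m)) (C : 'M[R]_(n, m)) :
  mx_measurable S -> mx_periodic S ->
  haar [set X | S (X + C)] = haar S.
Proof.
move=> mS pS.
have E (c : 'I_(n * m) -> R) t :
    mx_of_tuple (tuple_addr c t) = mx_of_tuple t + vec_mx (\row_k c k).
  by rewrite /mx_of_tuple -linearD; congr vec_mx; apply/rowP => k; rewrite !mxE tnth_mktuple.
rewrite /haar -(lebesgue_cube_addr (fun k => mxvec C ord0 k) mS).
  congr (lebesgue_cube R _ _); apply/seteqP; split => t /=; rewrite E;
  by rewrite (_ : \row_k _ = mxvec C) ?mxvecK//; apply/rowP => k; rewrite mxE.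
move=> t z /=; rewrite E (_ : vec_mx _ = map_mx intr (vec_mx (\row_k z k))).
  exact: mx_periodicE.
by apply/matrixP => i j; rewrite !mxE.
Qed.

End Haar.

(** * Images under integer matrices *)

Section HaarLinear.
Context (R : realType).
Local Notation tup k := (k.-tuple (measurableTypeR R)).
Local Notation "V '*z' X" := (map_mx intr V *m X) (at level 40).

Lemma measurable_mulmx_entry d (T : measurableType d) k n m (V : 'M[int]_(k, n))
    (phi : T -> 'M[R]_(n, m)) :
  (forall i j, measurable_fun setT (fun x => phi x i j : measurableTypeR R)) ->
  forall i j,
    measurable_fun setT (fun x => (V *z phi x) i j : measurableTypeR R).
Proof.
move=> mphi i j.
rewrite (_ : (fun x => _) = fun x => \sum_l (V i l)%:~R * phi x l j).
  apply: measurable_sum => l; apply: measurable_funM => //; exact: mphi.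
by apply/funext => x; rewrite mxE; apply: eq_bigr => l _; rewrite mxE.
Qed.

Lemma measurable_mx_of_tuple_comp d (T : measurableType d) n m
    (f : T -> tup (n * m)) : measurable_fun setT f ->
  forall i j,
    measurable_fun setT (fun x => mx_of_tuple (f x) i j : measurableTypeR R).
Proof.
by move=> mf i j; exact: (measurableT_comp (@measurable_mx_of_tuple R n m i j) mf).
Qed.

Lemma mx_measurable_mulmx k n m (V : 'M[int]_(k, n)) (S : set 'M[R]_(k, m)) :
  mx_measurable S -> mx_measurable [set X | S (V *z X)].
Proof.
move=> mS; apply: (mx_measurable_preimage (phi := fun t => V *z mx_of_tuple t)) => //.
by apply: measurable_mulmx_entry; exact: measurable_mx_of_tuple.
Qed.

Lemma mx_periodic_mulmx k n m (V : 'M[int]_(k, n)) (S : set 'M[R]_(k, m)) :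
  mx_periodic S -> mx_periodic [set X | S (V *z X)].
Proof. by move=> pS X Z SX /=; rewrite mulmxDr -map_mxM; exact: pS. Qed.

Lemma mx_measurableI n m (S S' : set 'M[R]_(n, m)) :
  mx_measurable S -> mx_measurable S' -> mx_measurable (S `&` S').
Proof. by move=> mS mS'; rewrite /mx_measurable preimage_setI; exact: measurableI. Qed.

Lemma mx_periodicI n m (S S' : set 'M[R]_(n, m)) :
  mx_periodic S -> mx_periodic S' -> mx_periodic (S `&` S').
Proof. by move=> pS pS' X Z [/pS ? /pS' ?]. Qed.

(* Both sections of {(X, Y) | S (V X + Y)} have constant measure: in Y by
   translation invariance, in X because Y is of the form V C. *)
Lemma haar_mulmx k n m (V : 'M[int]_(k, n)) (S : set 'M[R]_(k, m)) :
  (forall Y : 'M[R]_(k, m), exists C, V *z C = Y) ->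
  mx_measurable S -> mx_periodic S -> haar [set X | S (V *z X)] = haar S.
Proof.
move=> Vsurj mS pS.
pose B := [set p : tup (n * m) * tup (k * m) |
  S (V *z mx_of_tuple p.1 + mx_of_tuple p.2)].
apply/esym.
apply: (@probability_const_sections _ _ _ _ R (lebesgue_cube R (n * m))
  (lebesgue_cube R (k * m)) B).
- apply: (mx_measurable_preimage
    (phi := fun p => V *z mx_of_tuple p.1 + mx_of_tuple p.2)) => // i j.
  under eq_fun do rewrite mxE.
  apply: measurable_funD.
    exact: (measurable_mulmx_entry _ (measurable_mx_of_tuple_comp measurable_fst)).
  exact: (measurable_mx_of_tuple_comp measurable_snd).
- move=> t; rewrite -(haar_addr (V *z mx_of_tuple t) mS pS).
  congr (lebesgue_cube R _ _); apply/seteqP.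
  by split=> s; rewrite /xsection/= inE/= addrC.
- move=> s; have [C VC] := Vsurj (mx_of_tuple s).
  rewrite -(haar_addr C (@mx_measurable_mulmx _ _ _ V _ mS) (@mx_periodic_mulmx _ _ _ V _ pS)).
  congr (lebesgue_cube R _ _); apply/seteqP.
  by split=> t; rewrite /ysection/= inE/= mulmxDr VC.
Qed.

(** For fixed X the section of [B] is a product of translates of [S] and [S']. For fixed (Y, Y') it
    is a translate, by one C that solves both equations, of the set on the left. *)
Lemma haar_mulmx_indep k n m (V W : 'M[int]_(k, n)) (S S' : set 'M[R]_(k, m)) :
  (forall Y Y' : 'M[R]_(k, m), exists2 C, V *z C = Y & W *z C = Y') ->
  mx_measurable S -> mx_periodic S -> mx_measurable S' -> mx_periodic S' ->
  haar [set X | S (V *z X) /\ S' (W *z X)] = (haar S * haar S')%E.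
Proof.
move=> VWsurj mS pS mS' pS'.
pose B := [set p : tup (n * m) * (tup (k * m) * tup (k * m)) |
  S (V *z mx_of_tuple p.1 + mx_of_tuple p.2.1) /\
  S' (W *z mx_of_tuple p.1 + mx_of_tuple p.2.2)].
apply/esym.
apply: (@probability_const_sections _ _ _ _ R (lebesgue_cube R (n * m))
  (lebesgue_cube R (k * m) \x lebesgue_cube R (k * m))%E B).
- apply: measurableI.
    apply: (mx_measurable_preimage
      (phi := fun p => V *z mx_of_tuple p.1 + mx_of_tuple p.2.1)) => // i j.
    under eq_fun do rewrite mxE.
    apply: measurable_funD.
      exact: (measurable_mulmx_entry _ (measurable_mx_of_tuple_comp measurable_fst)).
    by apply: measurable_mx_of_tuple_comp; exact: measurableT_comp.
  apply: (mx_measurable_preimage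
    (phi := fun p => W *z mx_of_tuple p.1 + mx_of_tuple p.2.2)) => // i j.
  under eq_fun do rewrite mxE.
  apply: measurable_funD.
    exact: (measurable_mulmx_entry _ (measurable_mx_of_tuple_comp measurable_fst)).
  by apply: measurable_mx_of_tuple_comp; exact: measurableT_comp.
- move=> t.
  rewrite -(haar_addr (V *z mx_of_tuple t) mS pS).
  rewrite -(haar_addr (W *z mx_of_tuple t) mS' pS').
  rewrite /haar -product_measure1E.
  + congr ((_ \x _)%E _); apply/seteqP.
    split=> s; rewrite /xsection/= inE/= /B/=;
      by rewrite (addrC (V *z mx_of_tuple t)) (addrC (W *z mx_of_tuple t)).
  + apply: (mx_measurable_preimage (phi := fun s => mx_of_tuple s + V *z mx_of_tuple t)) => // i j.
    under eq_fun do rewrite mxE.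
    by apply: measurable_funD => //; exact: measurable_mx_of_tuple.
  + apply: (mx_measurable_preimage (phi := fun s => mx_of_tuple s + W *z mx_of_tuple t)) => // i j.
    under eq_fun do rewrite mxE.
    by apply: measurable_funD => //; exact: measurable_mx_of_tuple.
- move=> s; have [C VC WC] := VWsurj (mx_of_tuple s.1) (mx_of_tuple s.2).
  have mI := mx_measurableI (@mx_measurable_mulmx _ _ _ V _ mS)
    (@mx_measurable_mulmx _ _ _ W _ mS').
  have pI := mx_periodicI (@mx_periodic_mulmx _ _ _ V _ pS)
    (@mx_periodic_mulmx _ _ _ W _ pS').
  rewrite -(haar_addr C mI pI).
  congr (lebesgue_cube R _ _); apply/seteqP.
  by split=> t; rewrite /ysection/= inE/= !mulmxDr VC WC.
Qed.

End HaarLinear.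

(** * Borel-Cantelli lemmas *)

Section PairwiseIndependent.
Context d (T : measurableType d) (R : realType) (P : probability T R).
Local Open Scope ereal_scope.

(* With Z the number of events E_i that occur and t = 1/E[Z], integrate
   2 t Z <= 1_U + t^2 Z^2. *)
Lemma pairwise_indep_cover (I : finType) (E : I -> set T) (U : set T) :
  measurable U -> (forall i, measurable (E i)) -> (forall i, E i `<=` U) ->
  (forall i j, i != j -> P (E i `&` E j) = P (E i) * P (E j)) ->
  (0 < \sum_i fine (P (E i)))%R ->
  (1 - (\sum_i fine (P (E i)))^-1)%:E <= P U.
Proof.
move=> mU mE EU EE; set s := (\sum_i _)%R => s0; set t := (s^-1)%R.
have t0 : (0 <= t)%R by rewrite invr_ge0 ltW.
have mZ (A : set T) (c : R) : measurable A ->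
    measurable_fun setT (fun x => (c * \1_A x)%:E).
  by move=> mA; apply/measurable_EFinP; apply: measurable_funM.
have pZ (A : set T) (c : R) x : (0 <= c)%R -> 0 <= (c * \1_A x)%:E.
  by move=> c0; rewrite lee_fin mulr_ge0.
have iZ (A : set T) (c : R) : measurable A -> (0 <= c)%R ->
    \int[P]_x (c * \1_A x)%:E = c%:E * P A.
  move=> mA c0; under eq_integral do rewrite EFinM.
  rewrite ge0_integralZl_EFin ?integral_indic ?setIT//.
  by apply/measurable_EFinP.
have c0 : (0 <= 2 * t)%R by rewrite mulr_ge0.
have t20 : (0 <= t ^+ 2)%R by rewrite exprn_ge0.
have : \int[P]_x (\sum_(i <- index_enum I) ((2 * t) * \1_(E i) x)%:E) <=
    \int[P]_x ((1 * \1_U x)%:E + \sum_(i <- index_enum I)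
      \sum_(j <- index_enum I) (t ^+ 2 * \1_(E i `&` E j) x)%:E).
  apply: ge0_le_integral => //.
  - by move=> x _; apply: sume_ge0 => *; exact: pZ.
  - by apply: emeasurable_sum => i; exact: mZ.
  - apply: emeasurable_funD; first exact: mZ.
    by apply: emeasurable_sum => i; apply: emeasurable_sum => j; apply: mZ; exact: measurableI.
  - move=> x _; rewrite sumEFin; under [X in _ <= _ + X]eq_bigr do rewrite sumEFin.
    rewrite sumEFin -EFinD lee_fin -mulr_sumr.
    set Z := (\sum_(i <- index_enum I) \1_(E i) x)%R.
    rewrite (_ : (\sum_i _)%R = (t ^+ 2 * Z ^+ 2)%R); last first.
      rewrite [(Z ^+ 2)%R]expr2 /Z big_distrlr/= mulr_sumr; apply: eq_bigr => i _.
      by rewrite mulr_sumr; apply: eq_bigr => j _; rewrite indicI.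
    rewrite mul1r; have [xU|xU] := boolP (x \in U).
      have -> : (\1_U x = 1 :> R)%R by rewrite indicE xU.
      rewrite -subr_ge0; have -> : (1 + t ^+ 2 * Z ^+ 2 - 2 * t * Z = (1 - t * Z) ^+ 2)%R by ring.
      exact: sqr_ge0.
    suff -> : Z = 0%R by rewrite indicE (negbTE xU) !mulr0 expr0n mulr0 addr0.
    apply: big1 => i _; rewrite indicE memNset// => /EU xUi.
    by move/negP : xU; apply; rewrite inE.
rewrite ge0_integral_sum//; do ?[by move=> i; exact: mZ | by move=> *; exact: pZ].
rewrite ge0_integralD//; do ?[exact: mZ | by move=> x _; exact: pZ |
  by move=> x _; apply: sume_ge0 => i _; apply: sume_ge0 => j _; exact: pZ |
  by apply: emeasurable_sum => i; apply: emeasurable_sum => j; apply: mZ;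
    exact: measurableI].
rewrite iZ// mul1e ge0_integral_sum//; do ?[
  by move=> i x _; apply: sume_ge0 => j _; exact: pZ |
  by move=> i; apply: emeasurable_sum => j; apply: mZ; exact: measurableI].
rewrite [X in _ <= _ + X](_ : _ =
    \sum_i \sum_j ((t ^+ 2)%:E * P (E i `&` E j))); last first.
  apply: eq_bigr => i _; rewrite ge0_integral_sum//; do ?[
    by move=> j x _; exact: pZ | by move=> j; apply: mZ; exact: measurableI].
  by apply: eq_bigr => j _; rewrite iZ//; exact: measurableI.
under eq_bigr do rewrite iZ//.
pose p i := fine (P (E i)).
have pE i : P (E i) = (p i)%:E by rewrite fineK// fin_num_measure.
have p0 i : (0 <= p i)%R by rewrite fine_ge0.
have UE : P U = (fine (P U))%:E by rewrite fineK// fin_num_measure.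
under eq_bigr do rewrite pE -EFinM.
rewrite sumEFin -mulr_sumr -/s => h.
(* Independence says nothing on the diagonal, where the measure is p_i; this adds only s to the main
   term s^2, and t^2 (s^2 + s) = 1 + t. *)
have : \sum_i \sum_j ((t ^+ 2)%:E * P (E i `&` E j)) <=
    \sum_i \sum_j (t ^+ 2 * (p i * p j + (i == j)%:R * p i))%:E.
  apply: lee_sum => i _; apply: lee_sum => j _.
  rewrite [leRHS]EFinM lee_wpmul2l// ?lee_fin//.
  have [<-|ij] := eqVneq i j; first by rewrite setIid pE lee_fin mul1r lerDr mulr_ge0.
  by rewrite EE// !pE mul0r addr0.
rewrite [X in _ <= X](_ : _ = (t ^+ 2 * (s * s + s))%:E); last first.
  under eq_bigr do rewrite sumEFin.
  rewrite sumEFin; congr EFin.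
  have dE i : (\sum_j (i == j)%:R * p i = p i)%R.
    rewrite (bigD1 i)//= eqxx mul1r big1 ?addr0// => j.
    by rewrite eq_sym => /negbTE ->; rewrite mul0r.
  under eq_bigr do rewrite -mulr_sumr big_split/= -mulr_sumr dE.
  by rewrite -mulr_sumr big_split/= -mulr_suml.
move=> /(leeD2l (P U)) /(le_trans h).
rewrite UE -EFinD !lee_fin => {}h.
have ts : (t * s = 1)%R by rewrite mulVf// gt_eqF.
have : (t ^+ 2 * (s * s + s) = (t * s) * (t * s) + t * (t * s))%R by ring.
move: h; rewrite -mulrA ts; lra.
Qed.

(** Past any N there is a finite block of events of total measure above 1/e, so by
    [pairwise_indep_cover] the union from N on has measure at least 1 - e, for every e. *)
Lemma borel_cantelli_pairwise_indep (E : (set T)^nat) :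
  (forall i, measurable (E i)) ->
  (forall i j, i != j -> P (E i `&` E j) = P (E i) * P (E j)) ->
  \sum_(n <oo) P (E n) = +oo -> P (lim_sup_set E) = 1.
Proof.
move=> mE EE Eoo; pose p n := fine (P (E n)).
have pE n : P (E n) = (p n)%:E by rewrite fineK// fin_num_measure.
have p0 n : (0 <= p n)%R by rewrite fine_ge0.
have p1 n : (p n <= 1)%R by rewrite -lee_fin -pE probability_le1.
have bigsum (A : R) : exists M, (A < \sum_(0 <= i < M) p i)%R.
  apply: contrapT => /forallNP nM.
  suff : \sum_(n <oo) P (E n) <= A%:E by rewrite Eoo.
  apply: lime_le; first exact: is_cvg_nneseries.
  apply: nearW => M; under eq_bigr do rewrite pE.
  by rewrite sumEFin lee_fin leNgt; apply/negP/nM.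
have UN1 N : P (\bigcup_(k >= N) E k) = 1.
  have mU : measurable (\bigcup_(k >= N) E k) by exact: bigcup_measurable.
  apply/eqP; rewrite eq_le probability_le1//=; apply/lee_addgt0Pr => e e0.
  (* The summand N pays for the first N events, each of measure at most 1. *)
  have [M Mlt] := bigsum (e^-1 + N%:R)%R.
  pose F (i : 'I_M) := E (N + i)%N.
  have sE : (\sum_i fine (P (F i)) = \sum_(N <= i < N + M) p i)%R.
    by rewrite -{1}(add0n N) big_addn addKn big_mkord; apply: eq_bigr => i _; rewrite addnC.
  have se : (e^-1 < \sum_i fine (P (F i)))%R.
    rewrite sE -(ltrD2r N%:R) (lt_le_trans Mlt)//.
    have : (\sum_(0 <= i < M) p i <= \sum_(0 <= i < N + M) p i)%R.
      by rewrite addnC (big_cat_nat (leq0n M) (leq_addr N M))/= lerDl sumr_ge0.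
    move=> /le_trans; apply; rewrite (big_cat_nat (leq0n N) (leq_addr M N))/= addrC.
    rewrite lerD2l (le_trans (ler_sum _ (fun i _ => p1 i)))//.
    by rewrite big_const_nat subn0 iter_addr addr0.
  have s0 : (0 < \sum_i fine (P (F i)))%R by rewrite (lt_trans _ se)// invr_gt0.
  have := pairwise_indep_cover mU (fun i => mE (N + i)%N) (E := F).
  move=> /(_ _ _ s0) h.
  have {h} : (1 - (\sum_i fine (P (F i)))^-1)%:E <= P (\bigcup_(k >= N) E k).
    apply: h => [i x Ex|i j ij]; first by exists (N + i)%N => //=; exact: leq_addr.
    by apply: EE; rewrite eqn_add2l.
  move=> h; rewrite -leeBlDr// (le_trans _ h)// -EFinB lee_fin lerB//.
  by rewrite -[leRHS]invrK lef_pV2 ?posrE ?invr_gt0// ltW.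
have U0oo : P (\bigcup_(k >= 0) E k) < +oo by rewrite UN1 ltry.
have /cvg_lim <-// := lim_sup_set_cvg P E mE U0oo.
by rewrite (_ : (fun n => _) = cst 1) ?lim_cst//; apply/funext => n; exact: UN1.
Qed.

End PairwiseIndependent.

(** * Lines of integer vectors *)

Section Lines.
Context (n : nat).
Implicit Types (v w q : 'rV[int]_n) (d : int).

Lemma gcd_rowZ d q : gcd_row (d *: q) = (`|d| * gcd_row q)%N.
Proof.
rewrite /gcd_row (big_morph _ (muln_gcdr `|d|%N) (muln0 _)).
by apply: eq_bigr => j _; rewrite mxE abszM.
Qed.

Lemma gcd_rowN q : gcd_row (- q) = gcd_row q.
Proof. by rewrite -scaleN1r gcd_rowZ mul1n. Qed.

Lemma dvdn_gcd_row q j : (gcd_row q %| `|q ord0 j|)%N.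
Proof. by rewrite /gcd_row (bigD1 j) //= dvdn_gcdl. Qed.

Lemma gcd_row_eq0 q : (gcd_row q == 0%N) = (q == 0).
Proof.
apply/eqP/eqP => [q0|->]; last first.
  by rewrite /gcd_row big1_idem// => j _; rewrite mxE.
apply/rowP => j; have := dvdn_gcd_row q j.
by rewrite q0 dvd0n absz_eq0 mxE => /eqP.
Qed.

Lemma scale_row_eq0 d q : (d *: q == 0) = (d == 0) || (q == 0).
Proof. by rewrite -(gcd_row_eq0 (d *: q)) gcd_rowZ muln_eq0 absz_eq0 gcd_row_eq0. Qed.

Lemma scale_rowI d : d != 0 -> injective (fun q => d *: q).
Proof.
move=> /negbTE d0 v w /= /eqP.
by rewrite -subr_eq0 -scalerBr scale_row_eq0 d0 subr_eq0 => /eqP.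
Qed.

Lemma gcd_row_decomp q : exists2 v, q = (gcd_row q)%:Z *: v & (q != 0 -> gcd_row v = 1%N).
Proof.
pose v := \row_j (q ord0 j %/ (gcd_row q)%:Z)%Z.
have qE : q = (gcd_row q)%:Z *: v.
  apply/rowP => j; rewrite !mxE mulrC divzK//.
  by rewrite dvdzE/= dvdn_gcd_row.
exists v => //; rewrite -gcd_row_eq0 -lt0n => q0.
have /eqP := congr1 (@gcd_row n) qE.
by rewrite gcd_rowZ/= -{1}(muln1 (gcd_row q)) eqn_pmul2l// => /eqP.
Qed.

(* Of the two primitive vectors v, -v on a line, the one enumerated first. *)
Definition line_rep v := (gcd_row v == 1%N) && (pickle v <= pickle (- v))%N.

Lemma line_rep_neq0 v : line_rep v -> v != 0.
Proof. by move=> /andP[/eqP v1 _]; rewrite -gcd_row_eq0 v1. Qed.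

Lemma line_decomp q : q != 0 ->
  exists2 d, d != 0 & exists2 v, line_rep v & q = d *: v.
Proof.
move=> q0; have [v qE /(_ q0) v1] := gcd_row_decomp q.
have g0 : (gcd_row q)%:Z != 0 by rewrite eqz_nat gcd_row_eq0.
have [le|/ltnW le] := leqP (pickle v) (pickle (- v)).
  by exists (gcd_row q)%:Z => //; exists v => //; rewrite /line_rep v1 le.
exists (- (gcd_row q)%:Z); first by rewrite oppr_eq0.
by exists (- v); rewrite ?scaleNr ?scalerN ?opprK// /line_rep gcd_rowN v1 opprK.
Qed.

(** Comparing gcds gives d = d' or d = -d'. In the second case v = -v', and the two choices of sign
    in [line_rep] force v and v' to have the same code. *)
Lemma line_inj d d' v v' : line_rep v -> line_rep v' -> d != 0 ->
  d *: v = d' *: v' -> v = v' /\ d = d'.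
Proof.
move=> rv rv' d0 vv'.
have /andP[/eqP v1 lev] := rv; have /andP[/eqP v1' lev'] := rv'.
have dd' : `|d|%N = `|d'|%N.
  by have := congr1 (@gcd_row n) vv'; rewrite !gcd_rowZ v1 v1' !muln1.
suff vE : v = v'.
  split=> //; apply/eqP; rewrite -subr_eq0.
  have /eqP : (d - d') *: v = 0 by rewrite scalerBl vv' -vE subrr.
  by rewrite scale_row_eq0 (negbTE (line_rep_neq0 rv)) orbF.
have [E|E] : d = d' \/ d = - d' by lia.
  by apply: (scale_rowI d0); rewrite /= vv' E.
have vN : v = - v'.
  by apply: (scale_rowI d0); rewrite /= vv' E scaleNr scalerN opprK.
apply: (pcan_inj pickleK); apply/eqP; rewrite eqn_leq.
by move: lev lev'; rewrite vN opprK => -> ->.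
Qed.

(** If all 2 x 2 minors vanished, then w_j v = v_j w with v_j nonzero, and [line_inj] would give v =
    w. *)
Lemma line_indep v w : line_rep v -> line_rep w -> v != w ->
  exists j k, v ord0 j * w ord0 k - v ord0 k * w ord0 j != 0.
Proof.
move=> rv rw vw; apply: contrapT => dep.
have {}dep j k : v ord0 j * w ord0 k = v ord0 k * w ord0 j.
  apply/eqP; rewrite -subr_eq0; apply: contraPT isT => jk _.
  by apply: dep; exists j, k.
have [j vj] : exists j, v ord0 j != 0.
  apply: contrapT => v0; have := line_rep_neq0 rv; apply/negP; rewrite negbK.
  apply/eqP/rowP => j; rewrite mxE; apply/eqP; apply: contraPT isT => vj _.
  by apply: v0; exists j.
have vwE : w ord0 j *: v = v ord0 j *: w.
  by apply/rowP => k; rewrite !mxE dep mulrC.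
have [wv _] := line_inj rw rv vj (esym vwE).
by rewrite wv eqxx in vw.
Qed.

End Lines.

(** * Surjectivity of X |-> v X and X |-> (v X, w X) *)

Section Surjectivity.
Context (R : realType) (n m : nat).
Implicit Types (v w : 'rV[int]_n).
Local Notation "V '*z' X" := (map_mx intr V *m X) (at level 40).

Lemma mulmx_delta_row v (j : 'I_n) (Y : 'rV[R]_m) :
  v *z (delta_mx j ord0 *m Y) = (v ord0 j)%:~R *: Y.
Proof.
rewrite mulmxA -colE (_ : col j _ = ((v ord0 j)%:~R)%:M) ?mul_scalar_mx//.
by apply/matrixP => a b; rewrite !mxE !ord1.
Qed.

Lemma mulmx_row_surj v : v != 0 ->
  forall Y : 'rV[R]_m, exists C : 'M[R]_(n, m), v *z C = Y.
Proof.
move=> v0 Y; have [j vj] : exists j, v ord0 j != 0.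
  apply: contrapT => nv; move/negP : v0; apply.
  apply/eqP/rowP => j; rewrite mxE; apply/eqP; apply: contraPT isT => vj _.
  by apply: nv; exists j.
exists (delta_mx j ord0 *m ((v ord0 j)%:~R^-1 *: Y)).
by rewrite mulmx_delta_row scalerA divff ?scale1r// intr_eq0.
Qed.

Lemma mulmx_row2_surj v w : line_rep v -> line_rep w -> v != w ->
  forall Y Y' : 'rV[R]_m, exists2 C : 'M[R]_(n, m), v *z C = Y & w *z C = Y'.
Proof.
move=> rv rw vw Y Y'; have [j [k D0]] := line_indep rv rw vw.
pose D : R := (v ord0 j * w ord0 k - v ord0 k * w ord0 j)%:~R.
have {}D0 : D != 0 by rewrite intr_eq0.
have DE : D = (v ord0 j)%:~R * (w ord0 k)%:~R - (v ord0 k)%:~R * (w ord0 j)%:~R.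
  by rewrite /D intrB !intrM.
(* Only rows j and k of C are used; they solve the 2 x 2 system by Cramer's rule. *)
exists (delta_mx j ord0 *m (D^-1 *: ((w ord0 k)%:~R *: Y - (v ord0 k)%:~R *: Y')) +
        delta_mx k ord0 *m (D^-1 *: ((v ord0 j)%:~R *: Y' - (w ord0 j)%:~R *: Y)));
  rewrite mulmxDr !mulmx_delta_row; apply/rowP => i; rewrite !mxE;
  by rewrite DE; field; rewrite -DE.
Qed.

End Surjectivity.

(** * Borel-Cantelli lemmas over a countable index type *)

Section CountableBorelCantelli.
Context d (T : measurableType d) (R : realType) (P : probability T R).
Context (I : countType).
Implicit Types (F : I -> set T).

Lemma esum_pickle (a : I -> \bar R) : (forall i, 0 <= a i)%E ->
  \esum_(i in [set: I]) a i = (\sum_(j <oo) oapp a 0%E (pickle_inv j))%E.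
Proof.
move=> a0; rewrite nneseries_esumT; last by move=> j; case: pickle_inv => /=.
rewrite [RHS](esumID (range (@pickle I))); last by move=> j _; case: pickle_inv => /=.
rewrite [X in (_ + X)%E]esum1 ?adde0; last first.
  move=> j [_ /= nj]; have := @pickle_invK I j; case: pickle_inv => //= i ij.
  by case: nj; exists i.
rewrite setTI (reindex_esum [set: I] _ pickle).
  by apply: eq_esum => i _; rewrite pickleK_inv.
split=> [i _|i j _ _|//]; first by exists i.
exact: (pcan_inj pickleK_inv).
Qed.

Lemma infinite_set_pickle (Q : set I) :
  infinite_set Q <-> forall N, exists2 i, Q i & (N <= pickle i)%N.
Proof.
split=> [infQ N|QN finQ].
  apply: contrapT => nQ; apply: infQ.
  apply: (@sub_finite_set _ _ (pickle @^-1` `I_N)).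
    by move=> i Qi /=; rewrite ltnNge; apply/negP => Ni; apply: nQ; exists i.
  by apply: finite_preimage; [move=> ? ? _ _; exact: (pcan_inj pickleK)|exact: finite_II].
have /finite_seqP[s Qs] := finQ.
have [i Qi] := QN (\max_(i <- s) pickle i).+1.
by rewrite ltnNge => /negP; apply; apply: leq_bigmax_seq => //; move: Qi; rewrite Qs.
Qed.

(** Numbers that code no index get the empty set, which changes neither the limit superior nor the
    total measure and is independent of every event. *)
Definition pickle_sets F (j : nat) : set T := oapp F set0 (pickle_inv j).

Lemma lim_sup_pickle_sets F :
  lim_sup_set (pickle_sets F) = [set x | infinite_set [set i | F i x]].
Proof.
apply/seteqP; split=> x /= Fx.
  apply/infinite_set_pickle => N; have [j /= Nj] := Fx N Logic.I.
  rewrite /pickle_sets; have := @pickle_invK I j; case: pickle_inv => //= i ij Fix.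
  by exists i => //; rewrite ij.
move=> N _; have /infinite_set_pickle /(_ N)[i Fix Ni] := Fx.
by exists (pickle i) => //; rewrite /pickle_sets pickleK_inv.
Qed.

Lemma measurable_pickle_sets F : (forall i, measurable (F i)) ->
  forall j, measurable (pickle_sets F j).
Proof. by move=> mF j; rewrite /pickle_sets; case: pickle_inv => /=. Qed.

Lemma measurable_infinitely_many F : (forall i, measurable (F i)) ->
  measurable [set x | infinite_set [set i | F i x]].
Proof.
move=> mF; rewrite -lim_sup_pickle_sets; apply: bigcap_measurable => // N _.
by apply: bigcup_measurable => j _; exact: measurable_pickle_sets.
Qed.

Lemma esum_pickle_sets F : (forall i, measurable (F i)) ->
  (\sum_(j <oo) P (pickle_sets F j) = \esum_(i in [set: I]) P (F i))%E.
Proof.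
move=> mF; rewrite esum_pickle//; apply: eq_eseriesr => j _.
by rewrite /pickle_sets; case: pickle_inv => //=; rewrite measure0.
Qed.

Lemma borel_cantelli_countable F : (forall i, measurable (F i)) ->
  (\esum_(i in [set: I]) P (F i) < +oo)%E ->
  P [set x | infinite_set [set i | F i x]] = 0%E.
Proof.
move=> mF Foo; rewrite -lim_sup_pickle_sets; apply: lim_sup_set_cvg0.
  exact: measurable_pickle_sets.
by rewrite esum_pickle_sets.
Qed.

Lemma borel_cantelli_countable_pairwise_indep F :
  (forall i, measurable (F i)) ->
  (forall i j, i != j -> P (F i `&` F j) = P (F i) * P (F j))%E ->
  \esum_(i in [set: I]) P (F i) = +oo%E ->
  P [set x | infinite_set [set i | F i x]] = 1%E.
Proof.
move=> mF FF Foo; rewrite -lim_sup_pickle_sets.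
apply: borel_cantelli_pairwise_indep; first exact: measurable_pickle_sets.
  move=> j k jk; rewrite /pickle_sets.
  have := @pickle_invK I j; have := @pickle_invK I k.
  case: (pickle_inv j) => [i|]; last by rewrite /= set0I measure0 mul0e.
  case: (pickle_inv k) => [i'|]; last by rewrite /= setI0 measure0 mule0.
  move=> /= i'k ij; apply: FF; apply: contra_neq jk => ii'.
  by rewrite -ij -i'k ii'.
by rewrite esum_pickle_sets.
Qed.

End CountableBorelCantelli.

(** * Measure of the approximable points *)

Section NearCosets.
Context (R : realType).
Local Notation Rm := (measurableTypeR R).
Implicit Types (c r z : R) (g : nat).

Lemma measurable_ball_around c r : measurable ([set z | `|z - c| < r] : set Rm).
Proof.
rewrite (_ : [set z | _] = `]c - r, c + r[%classic); first exact: measurable_itv.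
by apply/seteqP; split => z /=; rewrite in_itv/= ltr_distlC; lra.
Qed.

Definition near_coset1 c g r : set Rm :=
  [set z | exists2 p : int, gcdn `|p| g = 1%N & `|z - (p%:~R + c)| < r].

Lemma measurable_near_coset1 c g r : measurable (near_coset1 c g r).
Proof.
rewrite (_ : near_coset1 c g r = \bigcup_(p : int)
    (if gcdn `|p| g == 1%N then [set z | `|z - (p%:~R + c)| < r] else set0)).
  apply: countable_bigcupT_measurable => // p.
  by case: ifP => // _; exact: measurable_ball_around.
apply/seteqP; split=> z /=.
  by move=> [p pg pz]; exists p => //; rewrite pg eqxx.
by move=> [p _]; case: ifP => // /eqP pg pz; exists p.
Qed.

Definition near_int c r : set Rm :=
  [set z | exists k : int, `|z - (k%:~R + c)| < r].

Lemma measurable_near_int c r : measurable (near_int c r).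
Proof.
rewrite (_ : near_int c r = near_coset1 c 1 r); first exact: measurable_near_coset1.
apply/seteqP; split=> z [p]; last by exists p.
by exists p => //; rewrite gcdn1.
Qed.

(** After translating the centre to 1/2, if r < 1/2 only the neighbourhood with k = 0 meets [0, 1),
    and it has length 2 r; if r >= 1/2 the bound is at least 1. *)
Lemma lebesgue01_near_int c r : 0 <= r ->
  (lebesgue01 (near_int c r) <= (2 * r)%:E)%E.
Proof.
move=> r0; pose e : R := c - 2^-1.
have -> : lebesgue01 (near_int c r) = lebesgue01 (near_int (2^-1) r).
  have mi a : measurable_fun setT (fun x : Rm => (\1_(near_int a r) x : R)%:E).
    by apply/measurable_EFinP; apply: measurable_indic; exact: measurable_near_int.
  rewrite -(setIT (near_int c r)) -(setIT (near_int (2^-1) r)).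
  rewrite -!integral_indic//; do ?exact: measurable_near_int.
  rewrite -[LHS](lebesgue01_periodic_addr e (mi c)).
  - apply: eq_integral => x _; congr EFin; rewrite !indicE; congr ((nat_of_bool _)%:R).
    apply/idP/idP; rewrite !inE => -[k xk]; exists k; move: xk;
    by rewrite (_ : x + e - (k%:~R + c) = x - (k%:~R + 2^-1))// /e; ring.
  - by move=> x; rewrite lee_fin.
  - move=> x; congr EFin; rewrite !indicE; congr ((nat_of_bool _)%:R).
    apply/idP/idP; rewrite !inE => -[k xk].
      by exists (k - 1); rewrite intrB (_ : _ - _ = x + 1 - (k%:~R + c))//; ring.
    by exists (k + 1); rewrite intrD (_ : _ - _ = x - (k%:~R + c))//; ring.
have [r2|r2] := leP 2^-1 r.
  apply: (@le_trans _ _ 1%E); first by apply: probability_le1; exact: measurable_near_int.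
  by rewrite lee_fin; lra.
rewrite /lebesgue01 /mrestr.
apply: (@le_trans _ _ (lebesgue_measure (`]2^-1 - r, 2^-1 + r[ : set Rm))).
  rewrite le_measure ?inE//; first by apply: measurableI => //; exact: measurable_near_int.
  move=> z [[k zk]] /=; rewrite !in_itv/= => /andP[z0 z1].
  move: zk; rewrite ltr_distlC => /andP[k1 k2].
  have [k0 k0'] : (k%:~R < 1 :> R) /\ (-1 < k%:~R :> R) by split; lra.
  have kE : k = 0 by move: k0 k0'; rewrite -[1]/(1%:~R) -[-1]/((-1)%:~R) !ltr_int; lia.
  by move: k1 k2; rewrite kE mulr0z add0r => k1 k2; apply/andP; split; lra.
rewrite lebesgue_measure_itv/= lte_fin; case: ifP => _; last by rewrite lee_fin; lra.
by rewrite -EFinB lee_fin; lra.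
Qed.

(** Sorting p by its residue a modulo g, which is coprime to g, covers the set by phi(g) sets
    [near_int] with centres (a + c) / g and radius r / g. *)
Lemma lebesgue01_near_coset1 c g r : (0 < g)%N -> 0 <= r ->
  (lebesgue01 [set z : Rm | near_coset1 c g r (g%:R * z)%R] <=
   ((2 * ((totient g)%:R * r / g%:R))%:E))%E.
Proof.
move=> g0 r0; have gR0 : 0 < g%:R :> R by rewrite ltr0n.
pose F (a : nat) : set Rm := if coprime g a then near_int ((a%:R + c) / g%:R) (r / g%:R) else set0.
have mF a : measurable (F a) by rewrite /F; case: ifP => // _; exact: measurable_near_int.
have mG : measurable [set z : Rm | near_coset1 c g r (g%:R * z)].
  rewrite -[X in measurable X]setTI.
  apply: (@mulrl_measurable _ setT g%:R) => //; exact: measurable_near_coset1.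
apply: (@le_trans _ _ (\sum_(a < g) lebesgue01 (F a))%E).
  apply: content_subadditive => // z [p pg pz].
  have gZ0 : g%:Z != 0 by rewrite eqz_nat -lt0n.
  have a0 : 0 <= (p %% g%:Z)%Z by rewrite modz_ge0.
  have ag : ((p %% g%:Z)%Z < g%:Z) by rewrite ltz_pmod.
  pose a := `|(p %% g%:Z)%Z|%N.
  have aE : a%:Z = (p %% g%:Z)%Z by rewrite /a gez0_abs.
  have alt : (a < g)%N by rewrite -ltz_nat aE.
  rewrite -bigcup_mkord; exists a => //; rewrite /F ifT.
    exists (p %/ g%:Z)%Z.
    have pE : p%:~R = (p %/ g%:Z)%Z%:~R * g%:R + a%:R :> R.
      by rewrite {1}(divz_eq p g%:Z) intrD intrM -aE.
    rewrite -(ltr_pM2l gR0) -{1}(gtr0_norm gR0) -normrM.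
    rewrite (mulrC g%:R (r / _)) divfK ?gt_eqF//.
    rewrite (_ : g%:R * _ = g%:R * z - (p%:~R + c))// pE; field.
    by rewrite gt_eqF.
  have := gcdz_modl p g%:Z.
  by rewrite -aE /gcdz/= pg => -[]; rewrite /coprime gcdnC => ->.
apply: (@le_trans _ _ (\sum_(a < g) ((coprime g a)%:R * (2 * (r / g%:R)))%:E)%E).
  apply: lee_sum => a _; rewrite /F; case: ifP => _; last by rewrite mul0r measure0.
  by rewrite mul1r; apply: lebesgue01_near_int; rewrite divr_ge0.
rewrite sumEFin lee_fin -mulr_suml -natr_sum totient_count_coprime big_mkord.
by rewrite le_eqVlt; apply/orP; left; apply/eqP; ring.
Qed.

End NearCosets.

Section Box.
Context (R : realType).
Local Notation Rm := (measurableTypeR R).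

Lemma measurable_box k (E : 'I_k -> set Rm) : (forall i, measurable (E i)) ->
  measurable [set t : k.-tuple Rm | forall i, E i (tnth t i)].
Proof.
move=> mE; rewrite (_ : [set t | _] = \bigcap_(i in [set: 'I_k]) ((fun t => tnth t i) @^-1` E i)).
  apply: fin_bigcap_measurable; first exact: finite_finset.
  by move=> i _; rewrite -[X in measurable X]setTI; exact: measurable_tnth.
by apply/seteqP; split=> [t Et i _|t Et i]; [exact: Et|exact: (Et i)].
Qed.

Lemma lebesgue_cube_box k (E : 'I_k -> set Rm) (c : R) : 0 <= c ->
  (forall i, measurable (E i)) -> (forall i, (lebesgue01 (E i) <= c%:E)%E) ->
  (lebesgue_cube R k [set t | forall i, E i (tnth t i)] <= (c ^+ k)%:E)%E.
Proof.
move=> c0; elim: k E => [|k IH] E mE Ec.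
  by rewrite expr0; apply: probability_le1; exact: measurable_box.
rewrite [X in (X <= _)%E](_ : _ = (@lebesgue01 R \x lebesgue_cube R k)%E
    (E ord0 `*` [set t | forall i, E (lift ord0 i) (tnth t i)])); last first.
  rewrite /= /distribution /pushforward; congr ((_ \x _)%E _).
  apply/seteqP; split => -[x t] /=.
    move=> Et; split; first by have := Et ord0; rewrite tnth0.
    by move=> i; have := Et (lift ord0 i); rewrite tnthS.
  move=> [Ex Et] i; case: (unliftP ord0 i) => [j ->|->]; rewrite ?tnthS ?tnth0//.
rewrite product_measure1E//. 2: exact: (measurable_box (E := fun i => E (lift ord0 i))).
rewrite exprS EFinM; apply: lee_pmul => //; first exact: Ec.
by apply: (IH (fun i => E (lift ord0 i))).
Qed.

End Box.

Section Approximable.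
Context (R : realType) (m : nat) (y : 'rV[R]_m).
Local Notation Rm := (measurableTypeR R).
Local Notation "V '*z' X" := (map_mx intr V *m X) (at level 40).

(* The ball of radius 0 is empty for every m, hence the first conjunct. *)
Definition near_coset g r : set 'rV[R]_m :=
  [set x | 0 < r /\ forall i, near_coset1 (y ord0 i) g r (x ord0 i)].

(** The gcd condition and the maximum norm both split over coordinates, so the p_i can be chosen
    separately. *)
Lemma approximableE n (psi : 'rV[int]_n -> R) q (X : 'M[R]_(n, m)) :
  approximable y psi q X <-> near_coset (gcd_row q) (psi q) (q *z X).
Proof.
split=> [[b [psi0 bB] [_ [p pP <-]] E]|[psi0 qX]].
  split=> // i; exists (p ord0 i); first exact: pP.
  rewrite -E !mxE addrK; have := bB ord0 i.
  by rewrite -ball_normE/= !mxE sub0r normrN.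
have /choice[p pP] i : exists p : int, gcdn `|p| (gcd_row q) = 1%N /\
    `|(q *z X) ord0 i - (p%:~R + y ord0 i)| < psi q.
  by have [p ? ?] := qX i; exists p.
pose p' : 'rV[int]_m := \row_i p i.
exists (q *z X - (map_mx intr p' + y)); last first.
  exists (map_mx intr p' + y); last by rewrite subrK.
  by exists p' => //= i; rewrite mxE; have [] := pP i.
split=> // i j; rewrite !ord1 -ball_normE/= mxE sub0r normrN.
by have [_] := pP j; rewrite !mxE.
Qed.

Lemma measurable_near_coset_comp d (T : measurableType d) (phi : T -> 'rV[R]_m) g r :
  (forall i, measurable_fun setT (fun x => phi x ord0 i : Rm)) ->
  measurable (phi @^-1` near_coset g r).
Proof.
move=> mphi; have [r0|r0] := ltP 0 r; last first.
  rewrite (_ : _ @^-1` _ = set0) ?measurable0// -subset0 => x [].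
  by rewrite ltNge r0.
rewrite (_ : _ @^-1` _ = \bigcap_(i in [set: 'I_m])
    ((fun x => phi x ord0 i) @^-1` near_coset1 (y ord0 i) g r)).
  apply: fin_bigcap_measurable; first exact: finite_finset.
  move=> i _; rewrite -[X in measurable X]setTI.
  by apply: mphi => //; exact: measurable_near_coset1.
by apply/seteqP; split=> [x [_ xr] i _|x xr]; [exact: xr|split=> // i; exact: xr].
Qed.

Lemma mx_measurable_approximable n (psi : 'rV[int]_n -> R) q :
  mx_measurable [set X : 'M[R]_(n, m) | approximable y psi q X].
Proof.
rewrite (_ : [set X | _] = [set X | near_coset (gcd_row q) (psi q) (q *z X)]).
  apply: measurable_near_coset_comp => i.
  by apply: measurable_mulmx_entry; exact: measurable_mx_of_tuple.
by apply/seteqP; split=> X /approximableE.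
Qed.

Lemma mx_periodic_approximable n (psi : 'rV[int]_n -> R) q :
  mx_periodic [set X : 'M[R]_(n, m) | approximable y psi q X].
Proof. by move=> X Z; exact: approximable_shift. Qed.

Lemma approximable_scale n (psi : 'rV[int]_n -> R) (v : 'rV[int]_n) (d : 'rV[int]_1)
    (X : 'M[R]_(n, m)) : gcd_row v = 1%N ->
  approximable y psi (d *m v) X <->
  approximable y (fun d => psi (d *m v)) d (v *z X).
Proof.
move=> v1; rewrite !approximableE map_mxM mulmxA.
rewrite (_ : gcd_row (d *m v) = gcd_row d)//.
rewrite {1}[d]mx11_scalar mul_scalar_mx gcd_rowZ v1 muln1.
by rewrite /gcd_row big_ord_recl big_ord0 gcdn0.
Qed.

(** With q = g v and v primitive, X |-> v X preserves measure and leaves a subset of T^m contained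
    in a box. The 2 is the length of a ball of radius 1. *)
Lemma haar_approximable n (psi : 'rV[int]_n -> R) (q : 'rV[int]_n) :
  0 <= psi q -> q != 0 ->
  (haar [set X : 'M[R]_(n, m) | approximable y psi q X] <=
   ((2 * ((totient (gcd_row q))%:R * psi q / (gcd_row q)%:R)) ^+ m)%:E)%E.
Proof.
move=> psi0 q0; set g := gcd_row q; set r := psi q.
have g0 : (0 < g)%N by rewrite lt0n gcd_row_eq0.
have [v qE /(_ q0) v1] := gcd_row_decomp q.
have v0 : v != 0 by rewrite -gcd_row_eq0 v1.
pose S := [set x : 'rV[R]_m | near_coset g r (g%:R *: x)].
have SE : [set X : 'M[R]_(n, m) | approximable y psi q X] = [set X | S (v *z X)].
  have qX (X : 'M[R]_(n, m)) : q *z X = g%:R *: (v *z X).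
    by rewrite {1}qE map_mxZ -scalemxAl.
  by apply/seteqP; split=> X; [move=> /approximableE|move=> SX; apply/approximableE];
     rewrite ?qX// -qX.
have mS : mx_measurable S.
  apply: measurable_near_coset_comp => i; under eq_fun do rewrite mxE.
  by apply: measurable_funM => //; exact: measurable_mx_of_tuple.
have pS : mx_periodic S.
  (* Periodicity is inherited by viewing [S] as approximability by the one-entry vector g. *)
  pose d : 'rV[int]_1 := const_mx g%:Z.
  have -> : S = [set X | approximable y (fun=> r) d X].
    have gd : gcd_row d = g by rewrite /gcd_row big_ord_recl big_ord0 gcdn0 mxE.
    have dX X : d *z X = g%:R *: X.
      by apply/rowP => i; rewrite !mxE big_ord_recl big_ord0 addr0 !mxE.
    by apply/seteqP; split=> X; [move=> SX; apply/approximableE|move=> /approximableE];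
       rewrite gd dX.
  exact: mx_periodic_approximable.
rewrite SE haar_mulmx//; last exact: mulmx_row_surj.
have [r0|r0] := ltP 0 r; last first.
  rewrite /haar (_ : _ @^-1` _ = set0); last first.
    by rewrite -subset0 => t [/=]; rewrite ltNge r0.
  by rewrite measure0 lee_fin exprn_ge0// mulr_ge0// divr_ge0// mulr_ge0.
pose E (i : 'I_(1 * m)) : set Rm :=
  [set z | near_coset1 (mxvec y ord0 i) g r (g%:R * z)].
have mE i : measurable (E i).
  rewrite -[X in measurable X]setTI.
  by apply: (@mulrl_measurable _ setT g%:R) => //; exact: measurable_near_coset1.
rewrite (_ : _ ^+ m = (2 * ((totient g)%:R * r / g%:R)) ^+ (1 * m)); last by rewrite mul1n.
apply: le_trans (lebesgue_cube_box (E := E) _ _ _) => //; last 2 first.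
- by rewrite mulr_ge0// divr_ge0// mulr_ge0// ltW.
- by move=> i; apply: lebesgue01_near_coset1 => //; exact: ltW.
rewrite /haar le_measure ?inE//; first exact: measurable_box.
move=> t [_ tS] i; case/mxvec_indexP: i => a j; rewrite ord1 /E/= mxvecE.
by have := tS j; rewrite mxE mx_of_tupleE.
Qed.

End Approximable.

(** * The convergence half *)

Lemma esum_natmul (R : realType) (T : choiceType) (D : set T) (b : T -> R) N :
  (forall i, D i -> 0 <= b i) ->
  \esum_(i in D) (b i *+ N)%:E = (\sum_(j < N) \esum_(i in D) (b i)%:E)%E.
Proof.
move=> b0; rewrite -esum_sum; last by move=> i j /b0; rewrite lee_fin.
apply: eq_esum => i _; rewrite sumEFin; congr EFin.
by rewrite big_const_ord iter_addr addr0.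
Qed.

Lemma esum_natmul_lty (R : realType) (T : choiceType) (D : set T) (b : T -> R) N :
  (forall i, D i -> 0 <= b i) -> (\esum_(i in D) (b i)%:E < +oo)%E ->
  (\esum_(i in D) (b i *+ N)%:E < +oo)%E.
Proof. by move=> b0 boo; rewrite esum_natmul//; apply: lte_sum_pinfty => j _. Qed.

Section Convergence.
Context (R : realType) (n m : nat) (y : 'rV[R]_m).
Implicit Types (psi : 'rV[int]_n -> R).

Lemma lebesgue_torus_Wset psi : lebesgue_torus R n m (Wset y psi) =
  haar [set X : 'M[R]_(n, m) | infinite_set [set q | q != 0 /\ approximable y psi q X]].
Proof.
rewrite /lebesgue_torus /distribution /pushforward; congr (lebesgue_cube R _ _).
by apply/seteqP; split=> t /WsetP.
Qed.

Lemma mx_measurable_approximable_neq0 psi q :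
  mx_measurable [set X : 'M[R]_(n, m) | q != 0 /\ approximable y psi q X].
Proof.
have [->|q0] := eqVneq q 0.
  rewrite /mx_measurable (_ : _ @^-1` _ = set0) ?measurable0//.
  by rewrite -subset0 => t [].
rewrite (_ : [set X | _] = [set X | approximable y psi q X]).
  exact: mx_measurable_approximable.
by apply/seteqP; split=> X //= [].
Qed.

Lemma haar_infinitely_approximable_lty psi : (forall q, 0 <= psi q) ->
  (idsc_series m psi < +oo)%E -> lebesgue_torus R n m (Wset y psi) = 0%E.
Proof.
move=> psi0 Soo; rewrite lebesgue_torus_Wset.
apply: (borel_cantelli_countable (P := lebesgue_cube R (n * m))
  (F := fun q => @mx_of_tuple R n m @^-1` [set X | q != 0 /\ approximable y psi q X])).
  by move=> q; exact: mx_measurable_approximable_neq0.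
have t0 q : 0 <= ((totient (gcd_row q))%:R * psi q / (gcd_row q)%:R) ^+ m.
  by rewrite exprn_ge0// divr_ge0// mulr_ge0.
rewrite (esumID [set q : 'rV[int]_n | q != 0])// setTI.
rewrite [X in (_ + X)%E]esum1 ?adde0; last first.
  move=> q [_ /= /negP]; rewrite negbK => /eqP ->.
  by rewrite (_ : _ @^-1` _ = set0) ?measure0 // -subset0 => t /= []; rewrite eqxx.
apply: le_lt_trans (esum_natmul_lty (2 ^ m) _ Soo) => //.
apply: le_esum => q q0.
rewrite (_ : [set X | _] = [set X | approximable y psi q X]); last first.
  by apply/seteqP; split=> X //= [].
apply: le_trans (haar_approximable y (psi0 q) q0) _.
by rewrite lee_fin [X in X <= _]exprMn -natrX mulr_natl.
Qed.

End Convergence.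

(** * Scaling by primes *)

Lemma primes_above (B : nat -> nat) : exists p : nat -> nat,
  [/\ forall j, prime (p j), forall i j, (i <= j)%N -> (B i < p j)%N &
      forall i j, (i < j)%N -> (p i < p j)%N].
Proof.
(* A sum bounds each of B 0, ..., B j and is simpler to handle than their maximum. *)
pose M j := (\sum_(i < j.+1) B i)%N.
pose nextp a := s2val (prime_above a).
have nextp_gt a : (a < nextp a)%N by rewrite /nextp; case: prime_above.
have nextp_prime a : prime (nextp a) by rewrite /nextp; case: prime_above.
pose fix p j := nextp (M j + if j is i.+1 then p i else 0)%N.
exists p; split=> [[|j]|i j ij|]; try exact: nextp_prime.
  have : (B i <= M j)%N by rewrite /M (bigD1 (Ordinal (ij : (i < j.+1)%N)))//= leq_addr.
  move=> /leq_ltn_trans; apply.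
  by case: j {ij} => [|j] /=; apply: leq_ltn_trans (nextp_gt _); exact: leq_addr.
have pS j : (p j < p j.+1)%N.
  by apply: leq_ltn_trans (nextp_gt _); exact: leq_addl.
move=> i; elim=> // j IH; rewrite ltnS leq_eqVlt => /predU1P[->//|/IH pij].
exact: ltn_trans (pS j).
Qed.

Lemma gcd_row1 (d : 'rV[int]_1) : gcd_row d = `|d ord0 ord0|%N.
Proof. by rewrite /gcd_row big_ord_recl big_ord0 gcdn0. Qed.

Lemma row1_eq0 (d : 'rV[int]_1) : (d == 0) = (d ord0 ord0 == 0).
Proof. by rewrite -gcd_row_eq0 gcd_row1 absz_eq0. Qed.

(** Otherwise p' would divide p |d|, although it is a prime larger than p and larger than |d|, which
    is nonzero. *)
Lemma scale_prime_inj (p p' : nat) (d d' : 'rV[int]_1) :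
  prime p -> prime p' -> (p < p')%N -> d != 0 -> (`|d ord0 ord0| < p')%N ->
  p%:Z *: d <> p'%:Z *: d'.
Proof.
move=> pp pp' pltp' d0 dp' /(congr1 (@gcd_row 1)).
rewrite !gcd_rowZ/= !gcd_row1 => E.
have : (p' %| p * `|d ord0 ord0|)%N by rewrite E dvdn_mulr.
rewrite Euclid_dvdM// dvdn_prime2// => /orP[/eqP E'|].
  by rewrite E' ltnn in pltp'.
by move=> /dvdn_leq; rewrite absz_gt0 -row1_eq0 leqNgt dp' => /(_ d0).
Qed.

(** Since phi(p g) = (p - 1) phi(g) and p <= 2 (p - 1), scaling by p at most halves phi(g)/g. *)
Lemma totient_mul_prime (p g : nat) : prime p -> (0 < g)%N -> (g < p)%N ->
  (totient g * p <= 2 * totient (p * g))%N.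
Proof.
move=> pp g0 gp; rewrite totient_coprime; last first.
  by rewrite prime_coprime// gtnNdvd.
rewrite (totient_prime pp) mulnA mulnC leq_mul2r; have := prime_gt1 pp; lia.
Qed.

Lemma esum_subset (R : realType) (T : choiceType) (D D' : set T) (a : T -> \bar R) :
  D `<=` D' -> (forall i, D' i -> 0 <= a i)%E ->
  (\esum_(i in D) a i <= \esum_(i in D') a i)%E.
Proof.
move=> DD' a0; rewrite [leRHS](esumID D)// setIidr//.
by rewrite leeDl// esum_ge0// => i [/a0].
Qed.

(** A positive finite sum exceeds its half, hence so does some finite partial sum. *)
Lemma esum_half_finite (R : realType) (T : choiceType) (D : set T) (a : T -> \bar R) :
  (forall i, D i -> 0 <= a i)%E -> (\esum_(i in D) a i < +oo)%E ->
  exists D', [/\ finite_set D', D' `<=` D &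
    (\esum_(i in D) a i <= \esum_(i in D') a i + \esum_(i in D') a i)%E].
Proof.
move=> a0 aoo; have S0 : (0 <= \esum_(i in D) a i)%E by exact: esum_ge0.
have [E|Sn0] := eqVneq (\esum_(i in D) a i)%E 0%E.
  by exists set0; split=> //; rewrite E !esum_set0 adde0.
pose s := fine (\esum_(i in D) a i).
have sE : \esum_(i in D) a i = s%:E by rewrite fineK// ge0_fin_numE.
have s0 : 0 < s by rewrite -lte_fin -sE lt_def Sn0 S0.
have : ((s / 2)%:E < \esum_(i in D) a i)%E by rewrite sE lte_fin; lra.
rewrite {1}/esum => /ereal_sup_gt[_ [X [finX XD] <-] sX]; exists X; split=> //.
rewrite [in leRHS]esum_fset//; last by move=> i /set_mem/XD/a0.
rewrite sE (_ : s%:E = (s / 2)%:E + (s / 2)%:E)%E; first by apply: leeD; exact: ltW.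
by rewrite -EFinD; congr EFin; lra.
Qed.

(** * Total measure of the events attached to lines *)

Section Overlap.
Context (R : realType) (m : nat) (y : 'rV[R]_m).

Definition approximable_some (theta : 'rV[int]_1 -> R) : set 'rV[R]_m :=
  [set x | exists2 d, d != 0 & approximable y theta d x].

Lemma mx_measurable_approximable_some theta : mx_measurable (approximable_some theta).
Proof.
rewrite /mx_measurable (_ : _ @^-1` _ = \bigcup_(d : 'rV[int]_1) @mx_of_tuple R 1 m @^-1`
    [set x | d != 0 /\ approximable y theta d x]).
  by apply: countable_bigcupT_measurable => // d; exact: mx_measurable_approximable_neq0.
apply/seteqP; split=> t /=; first by move=> [d d0 dt]; exists d.
by move=> [d _ [d0 dt]]; exists d.
Qed.

Lemma mx_periodic_approximable_some theta : mx_periodic (approximable_some theta).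
Proof. by move=> X Z [d d0 dX]; exists d => //; exact: approximable_shift. Qed.

Lemma lt0_approximable n (psi : 'rV[int]_n -> R) q (X : 'M[R]_(n, m)) :
  approximable y psi q X -> 0 < psi q.
Proof. by move=> /approximableE[]. Qed.

(** Here (p d) x = d (p x), and an integer coprime to p |d| is coprime to |d|. The converse fails,
    but only this direction is used. *)
Lemma approximable_scale_nat (theta Psi : 'rV[int]_1 -> R) (p : nat)
    (d : 'rV[int]_1) (x : 'rV[R]_m) : Psi (p%:Z *: d) = theta d ->
  approximable y Psi (p%:Z *: d) x ->
  approximable y theta d (map_mx intr (const_mx p%:Z : 'M[int]_1) *m x).
Proof.
move=> Pd /approximableE[r0 xr]; apply/approximableE; split; first by rewrite -Pd.
move=> i; have [k kg kx] := xr i; exists k.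
  apply/eqP; move/eqP: kg; rewrite gcd_rowZ/= !gcd_row1.
  exact/coprime_dvdr/dvdn_mull.
rewrite -Pd; move: kx; congr (`|_ - _| < _).
rewrite !mxE !big_ord_recl !big_ord0 !addr0 !mxE !big_ord_recl !big_ord0 !mxE.
by rewrite !addr0 intrM mulrCA mulrA.
Qed.

(* If the sum were finite, spread the theta_i over disjoint sets of integers by
   Psi (p_i d) = theta_i d with p_i distinct large primes. The series of Psi
   still diverges, but multiplication by p_i maps the points approximable at p_i d
   for some d into a set of finite total measure, against IDSC 1. *)
Lemma esum_haar_approximable_some (I : countType) (theta : I -> 'rV[int]_1 -> R) :
  IDSC 1 m y -> (forall i d, 0 <= theta i d) ->
  (forall i, idsc_series m (theta i) < +oo)%E ->
  \esum_(i in [set: I]) idsc_series m (theta i) = +oo%E ->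
  \esum_(i in [set: I]) haar (approximable_some (theta i)) = +oo%E.
Proof.
move=> idsc1 theta0 Sfin Soo; apply: contrapT => /eqP; rewrite -ltey => Hoo.
pose term r (d : 'rV[int]_1) : R := ((totient (gcd_row d))%:R * r / (gcd_row d)%:R) ^+ m.
have term0 r d : 0 <= r -> 0 <= term r d.
  by move=> r0; rewrite exprn_ge0// divr_ge0// mulr_ge0.
have /choice[D DP] i : exists D : set 'rV[int]_1, [/\ finite_set D, D `<=` [set d | d != 0] &
    (idsc_series m (theta i) <= \esum_(d in D) (term (theta i d) d)%:E +
      \esum_(d in D) (term (theta i d) d)%:E)%E].
  by apply: esum_half_finite; [move=> d _; rewrite lee_fin term0|exact: Sfin].
have /choice[N NP] i : exists N : nat, forall d, D i d -> (`|d ord0 ord0| < N)%N.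
  have [/finite_seqP[s Ds] _ _] := DP i.
  exists (\max_(d <- s) `|(d : 'rV[int]_1) ord0 ord0|)%N.+1 => d; rewrite Ds => ds.
  by rewrite ltnS; apply: leq_bigmax_seq.
pose B j := if pickle_inv j is Some i then N i else 0%N.
have [P [P_prime PB P_lt]] := primes_above B.
pose p (i : I) := P (pickle i).
(* For i before i' this separates the scaled copies; for i = i' it makes p_i coprime to d, as the
   totient bound requires. *)
have p_gt i i' d : (pickle i <= pickle i')%N -> D i d -> (`|d ord0 ord0| < p i')%N.
  move=> ii' Dd; apply: ltn_trans (NP _ _ Dd) _.
  by have := PB _ _ ii'; rewrite /B pickleK_inv.
pose K : set (I * 'rV[int]_1) := [set: I] `*`` D.
pose e (k : I * 'rV[int]_1) := (p k.1)%:Z *: k.2.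
have p0 i : (p i)%:Z != 0 by rewrite eqz_nat -lt0n prime_gt0 ?P_prime.
have e0 k : K k -> e k != 0.
  case: k => i d [_ /= Dd]; rewrite /e scale_row_eq0 (negbTE (p0 i))/=.
  by have [_ + _] := DP i; exact.
have e_inj : set_inj K e.
  move=> [i d] [i' d']; rewrite !inE => Kk Kk'; rewrite /e/= => E.
  have [_ /= Dd] := Kk; have [_ /= Dd'] := Kk'.
  have d0 : d != 0 by have [_ + _] := DP i; exact.
  have d0' : d' != 0 by have [_ + _] := DP i'; exact.
  have [lt|gt|/(pcan_inj pickleK) ii'] := ltngtP (pickle i) (pickle i').
  - by case: (scale_prime_inj (P_prime _) (P_prime _) (P_lt _ _ lt) d0
      (p_gt _ _ _ (ltnW lt) Dd) E).
  - by case: (scale_prime_inj (P_prime _) (P_prime _) (P_lt _ _ gt) d0'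
      (p_gt _ _ _ (ltnW gt) Dd') (esym E)).
  - by move: E; rewrite ii' => /(scale_rowI (p0 i')) ->.
(* The value 0 off the scaled copies makes every approximating q a point of some copy. *)
pose Psi q : R := if pselect (exists2 k, K k & e k = q) is left H
  then theta (s2val (cid2 H)).1 (s2val (cid2 H)).2 else 0.
have PsiE k : K k -> Psi (e k) = theta k.1 k.2.
  move=> Kk; rewrite /Psi; case: pselect => [H|]; last by case; exists k.
  case: cid2 => /= k' Kk' ekk'.
  by rewrite (e_inj _ _ (mem_set Kk') (mem_set Kk) ekk').
have Psi0 q : 0 <= Psi q by rewrite /Psi; case: pselect.
have PsiP q : 0 < Psi q -> exists2 k, K k & e k = q.
  by rewrite /Psi; case: pselect => //; rewrite ltxx.
have SPsi : idsc_series m Psi = +oo%E.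
  apply/eqP; rewrite -leye_eq leNgt; apply/negP => SPsi.
  pose X := \esum_(i in [set: I]) \esum_(d in D i) (term (theta i d) d)%:E.
  have X2 : (X + X)%E = +oo%E.
    rewrite /X -esumD; do ?[by move=> i _; apply: esum_ge0 => d _; rewrite lee_fin term0].
    apply/eqP; rewrite -leye_eq -Soo; apply: le_esum => i _.
    by have [] := DP i.
  suff : (X < +oo)%E by move=> Xoo; have := lte_add_pinfty Xoo Xoo; rewrite X2 ltxx.
  rewrite /X esum_esum; last by move=> i d _ _; rewrite lee_fin term0.
  have termP q : 0 <= term (Psi q) q by rewrite term0.
  (* The factor 2 ^ m is the m-th power of the loss in [totient_mul_prime]. *)
  apply: le_lt_trans (esum_natmul_lty (2 ^ m) _ SPsi); last by move=> q _; exact: termP.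
  rewrite (le_trans _ (esum_subset (D := e @` K) _ _))//; first last.
  - by move=> q _; rewrite lee_fin mulrn_wge0// termP.
  - by move=> _ [k Kk <-]; exact: e0.
  rewrite (reindex_esum K _ e); last by split.
  apply: le_esum => -[i d] Kk; have [_ /= Dd] := Kk; rewrite lee_fin.
  have d0 : d != 0 by have [_ + _] := DP i; exact.
  have g0 : (0 < gcd_row d)%N by rewrite lt0n gcd_row_eq0.
  have gR0 : 0 < (gcd_row d)%:R :> R by rewrite ltr0n.
  have pR0 : 0 < (p i)%:R :> R by rewrite ltr0n prime_gt0 ?P_prime.
  rewrite PsiE// /term /e/= gcd_rowZ/= -[leRHS]mulr_natl natrX -exprMn lerXn2r ?nnegrE//.
  - by rewrite divr_ge0// mulr_ge0.
  - by rewrite mulr_ge0// divr_ge0// mulr_ge0.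
  rewrite ler_pdivrMr// natrM.
  have -> : 2 * ((totient (p i * gcd_row d))%:R * theta i d /
      ((p i)%:R * (gcd_row d)%:R)) * (gcd_row d)%:R
      = (2 * (totient (p i * gcd_row d))%:R / (p i)%:R) * theta i d :> R.
    by field; rewrite !gt_eqF.
  rewrite ler_wpM2r// ler_pdivlMr// -!natrM ler_nat totient_mul_prime ?P_prime//.
  by rewrite gcd_row1; exact: p_gt Dd.
have [_ /(_ SPsi)] := idsc1 Psi Psi0; rewrite lebesgue_torus_Wset => full.
pose pm i : 'M[int]_1 := const_mx (p i)%:Z.
have pm_surj i (Y : 'rV[R]_m) : exists C, map_mx intr (pm i) *m C = Y.
  apply: mulmx_row_surj; apply: contra (p0 i) => /eqP/matrixP/(_ ord0 ord0).
  by rewrite !mxE => ->.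
pose G i := [set x : 'rV[R]_m | approximable_some (theta i) (map_mx intr (pm i) *m x)].
have mG i : mx_measurable (G i).
  by apply: mx_measurable_mulmx; exact: mx_measurable_approximable_some.
pose Glim := [set t | infinite_set [set i | (@mx_of_tuple R 1 m @^-1` G i) t]].
have : (lebesgue_cube R (1 * m) Glim = 0)%E.
  apply: borel_cantelli_countable => //.
  apply: le_lt_trans Hoo; apply: le_esum => i _.
  rewrite -(haar_mulmx (pm_surj i))//; first exact: mx_measurable_approximable_some.
  exact: mx_periodic_approximable_some.
suff : (1 <= lebesgue_cube R (1 * m) Glim)%E.
  by move=> + E; rewrite E lee_fin ler10.
rewrite -full; apply: le_measure; rewrite ?inE.
- apply: (measurable_infinitely_many (F := fun q => @mx_of_tuple R 1 m @^-1`
    [set X | q != 0 /\ approximable y Psi q X])) => q.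
  exact: mx_measurable_approximable_neq0.
- exact: measurable_infinitely_many.
(* Every approximating q is p_i d with d in [D i], and puts t in [G i]. If finitely many [G i]
   contain t, finiteness of the [D i] leaves finitely many q. *)
move=> t /=; apply: contra_not => finG.
apply: (@sub_finite_set _ _ (\bigcup_(i in [set i | G i (mx_of_tuple t)])
  ((fun d => e (i, d)) @` D i))).
  move=> q [q0 qt]; have [[i d] Kk ekq] := PsiP _ (lt0_approximable qt).
  have [_ /= Dd] := Kk; exists i => /=; last by exists d.
  exists d; first by have [_ + _] := DP i; exact.
  apply: (approximable_scale_nat (Psi := Psi)); first exact: (PsiE _ Kk).
  by rewrite -/(e (i, d)) ekq.
apply: bigcup_finite => // i _; apply: finite_image.
by have [] := DP i.
Qed.

End Overlap.

(** * Reduction to lines *)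

Lemma mul_row1_mx n (d : 'rV[int]_1) (v : 'rV[int]_n) : d *m v = d ord0 ord0 *: v.
Proof. by rewrite {1}[d]mx11_scalar mul_scalar_mx. Qed.

Lemma gcd_row_mul_primitive n (d : 'rV[int]_1) (v : 'rV[int]_n) :
  gcd_row v = 1%N -> gcd_row (d *m v) = gcd_row d.
Proof. by move=> v1; rewrite mul_row1_mx gcd_rowZ v1 muln1 gcd_row1. Qed.

Section Reduction.
Context (R : realType) (n m : nat) (y : 'rV[R]_m) (psi : 'rV[int]_n -> R).
Hypothesis psi0 : forall q, 0 <= psi q.

(** The value 0 for other v lets sums and events run over all integer vectors instead of a
    subtype. *)
Definition line_restriction (v : 'rV[int]_n) (d : 'rV[int]_1) : R :=
  if line_rep v then psi (d *m v) else 0.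

Lemma line_restriction_ge0 v d : 0 <= line_restriction v d.
Proof. by rewrite /line_restriction; case: ifP. Qed.

Lemma approximable_some_line v (x : 'rV[R]_m) :
  approximable_some y (line_restriction v) x -> line_rep v.
Proof.
move=> [d _ /lt0_approximable]; rewrite /line_restriction.
by case: ifP => //; rewrite ltxx.
Qed.

Lemma approximable_line_restriction v d (X : 'M[R]_(n, m)) : line_rep v ->
  approximable y (line_restriction v) d (map_mx intr v *m X) <->
  approximable y psi (d *m v) X.
Proof.
move=> rv; have /andP[/eqP v1 _] := rv.
by rewrite approximable_scale// /line_restriction rv.
Qed.

(** The map (v, d) |-> d v is a bijection from representatives and nonzero d to nonzero q, and it
    keeps the terms because v is primitive. *)
Lemma esum_line_restriction : idsc_series m psi = +oo%E ->
  \esum_(v in [set: 'rV[int]_n]) idsc_series m (line_restriction v) = +oo%E.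
Proof.
move=> Soo; apply/eqP; rewrite -leye_eq -Soo.
pose t (q : 'rV[int]_n) := ((totient (gcd_row q))%:R * psi q / (gcd_row q)%:R) ^+ m.
have t0 q : 0 <= t q by rewrite exprn_ge0// divr_ge0// mulr_ge0.
pose L : set 'rV[int]_n := [set v | line_rep v].
pose e (k : 'rV[int]_n * 'rV[int]_1) := k.2 *m k.1.
rewrite {1}/idsc_series (reindex_esum (L `*`` fun=> [set d : 'rV[int]_1 | d != 0]) _ e); last first.
  split.
  - move=> [v d] [/= rv d0]; rewrite /e/= mul_row1_mx scale_row_eq0 negb_or.
    by rewrite (line_rep_neq0 rv) andbT -row1_eq0.
  - move=> [v d] [v' d']; rewrite !inE => -[/= rv d0] [/= rv' d0'].
    rewrite /e/= !mul_row1_mx row1_eq0 in d0 *.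
    move=> /(line_inj rv rv' d0)[-> dd']; congr (_, _).
    by apply/rowP => i; rewrite !ord1.
  - move=> q /= /line_decomp[d d0 [v rv ->]]; exists (v, const_mx d).
      by split=> //=; rewrite row1_eq0 mxE.
    by rewrite /e/= mul_row1_mx mxE.
rewrite -(esum_esum (a := fun v d => (t (d *m v))%:E)); last by move=> *; rewrite lee_fin.
apply: le_trans (esum_subset (D := L) _ _) => //; last first.
  move=> v _; apply: esum_ge0 => d _.
  by rewrite lee_fin exprn_ge0// divr_ge0// mulr_ge0// line_restriction_ge0.
apply: le_esum => v rv; have /andP[/eqP v1 _] := rv.
by apply: le_esum => d d0; rewrite /t /line_restriction rv gcd_row_mul_primitive.
Qed.

Lemma measurable_infinitely_approximable k (phi : 'rV[int]_k -> R) :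
  mx_measurable [set X : 'M[R]_(k, m) |
    infinite_set [set q | q != 0 /\ approximable y phi q X]].
Proof.
apply: (measurable_infinitely_many (F := fun q => @mx_of_tuple R k m @^-1`
  [set X | q != 0 /\ approximable y phi q X])) => q.
exact: mx_measurable_approximable_neq0.
Qed.

Lemma haar_le1 k l (S : set 'M[R]_(k, l)) : mx_measurable S -> (haar S <= 1)%E.
Proof. by move=> mS; apply: probability_le1. Qed.

Lemma le_haar k l (S S' : set 'M[R]_(k, l)) : mx_measurable S -> mx_measurable S' ->
  S `<=` S' -> (haar S <= haar S')%E.
Proof. by move=> mS mS' SS'; apply: le_measure; rewrite ?inE// => t; exact: SS'. Qed.

(** IDSC 1 gives full measure to a set of v X, hence to its preimage; d |-> d v is injective, so
    infinitely many d yield infinitely many q. *)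
Lemma haar_one_line v : IDSC 1 m y -> line_rep v ->
  idsc_series m (line_restriction v) = +oo%E ->
  (1 <= haar [set X : 'M[R]_(n, m) |
    infinite_set [set q | q != 0%R /\ approximable y psi q X]])%E.
Proof.
move=> idsc1 rv Soo; have [_ /(_ Soo)] := idsc1 _ (line_restriction_ge0 v).
rewrite lebesgue_torus_Wset; set S := [set X | _] => S1.
have mS : mx_measurable S by exact: measurable_infinitely_approximable.
have pS : mx_periodic S.
  move=> X Z; apply: contra_not; apply: sub_finite_set => d [d0 dX]; split=> //.
  exact: approximable_shift.
rewrite -S1 -(haar_mulmx (mulmx_row_surj (line_rep_neq0 rv)) mS pS).
apply: le_haar; [exact: mx_measurable_mulmx|exact: measurable_infinitely_approximable|].
move=> X /=; apply: contra_not => finQ.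
have injv : {in [set: 'rV[int]_1] &, injective (fun d => d *m v)}.
  move=> d d' _ _; rewrite !mul_row1_mx => dd'.
  apply/rowP => i; rewrite !ord1; have [|d0] := eqVneq (d ord0 ord0) 0.
    move=> d0; move: dd' => /esym /eqP; rewrite d0 scale0r scale_row_eq0.
    by rewrite (negbTE (line_rep_neq0 rv)) orbF => /eqP ->.
  by have [_ ->] := line_inj rv rv d0 dd'.
apply: (@sub_finite_set _ _ ((fun d : 'rV[int]_1 => d *m v) @^-1`
    [set q | q != 0 /\ approximable y psi q X])); last first.
  by apply: finite_preimage => // d d' _ _; apply: injv; rewrite inE.
move=> d [d0 dX] /=; split; last exact/approximable_line_restriction.
by rewrite mul_row1_mx scale_row_eq0 negb_or -row1_eq0 d0 (line_rep_neq0 rv).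
Qed.

(** Almost every X lies in the events of infinitely many lines. Each supplies a nonzero q, and no q
    lies on two lines, so infinitely many q occur. *)
Lemma haar_many_lines : IDSC 1 m y ->
  (forall v, idsc_series m (line_restriction v) < +oo)%E ->
  idsc_series m psi = +oo%E ->
  (1 <= haar [set X : 'M[R]_(n, m) |
    infinite_set [set q | q != 0%R /\ approximable y psi q X]])%E.
Proof.
move=> idsc1 Sfin Soo.
have Hoo := esum_haar_approximable_some idsc1 line_restriction_ge0 Sfin
  (esum_line_restriction Soo).
pose F v := [set X : 'M[R]_(n, m) |
  approximable_some y (line_restriction v) (map_mx intr v *m X)].
have mF v : mx_measurable (F v).
  by apply: mx_measurable_mulmx; exact: mx_measurable_approximable_some.
have mA v := mx_measurable_approximable_some y (line_restriction v).
have pA v : mx_periodic (approximable_some y (line_restriction v)).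
  exact: mx_periodic_approximable_some.
have F0 v : ~~ line_rep v -> F v = set0.
  by move=> rv; rewrite -subset0 => X /approximable_some_line; exact/negP.
have FE v : haar (F v) = haar (approximable_some y (line_restriction v)).
  have [rv|rv] := boolP (line_rep v).
    exact: (haar_mulmx (mulmx_row_surj (line_rep_neq0 rv)) (mA v) (pA v)).
  rewrite F0// (_ : approximable_some _ _ = set0) /haar ?preimage_set0 ?measure0//.
  by rewrite -subset0 => X /approximable_some_line; exact/negP.
have FF v w : v != w -> haar (F v `&` F w) = (haar (F v) * haar (F w))%E.
  move=> vw; have [rv|/F0->] := boolP (line_rep v); last first.
    by rewrite set0I /haar preimage_set0 measure0 mul0e.
  have [rw|/F0->] := boolP (line_rep w); last first.
    by rewrite setI0 /haar preimage_set0 measure0 mule0.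
  by rewrite (haar_mulmx_indep (mulmx_row2_surj rv rw vw))// -!FE.
have <- : haar [set X | infinite_set [set v | F v X]] = 1%E.
  apply: (borel_cantelli_countable_pairwise_indep
    (F := fun v => @mx_of_tuple R n m @^-1` F v)) => //.
  by rewrite -Hoo; apply: eq_esum => v _; exact: FE.
apply: le_haar.
- exact: (measurable_infinitely_many (F := fun v => @mx_of_tuple R n m @^-1` F v)).
- exact: measurable_infinitely_approximable.
move=> X /=; apply: contra_not => finQ; set Q := [set q | _] in finQ.
apply: (@sub_finite_set _ _ (\bigcup_(q in Q)
    [set v | line_rep v /\ exists2 d, d != 0 & q = d *: v])).
  move=> v Fv; have rv := approximable_some_line Fv; have [d d0 dX] := Fv.
  have d0' : d ord0 ord0 != 0 by rewrite -row1_eq0.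
  exists (d *m v); last by split=> //; exists (d ord0 ord0); rewrite ?mul_row1_mx.
  split; last exact/approximable_line_restriction.
  by rewrite mul_row1_mx scale_row_eq0 negb_or d0' (line_rep_neq0 rv).
apply: bigcup_finite => // q [/line_decomp[d d0 [v rv ->]] _].
apply: (@sub_finite_set _ _ [set v]) => // w [rw [d' d0' E]].
by have [-> _] := line_inj rv rw d0 E.
Qed.

End Reduction.

Theorem theorem2p5 (R : realType) (m : nat) (hm : (0 < m)%N) (y : 'rV[R]_m) :
  IDSC 1 m y -> forall n : nat, (1 <= n)%N -> IDSC n m y.
Proof.
move=> idsc1 n _ psi psi0; split=> [|Soo].
  exact: haar_infinitely_approximable_lty.
rewrite lebesgue_torus_Wset; apply/eqP; rewrite eq_le.
rewrite haar_le1/=; last exact: measurable_infinitely_approximable.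
have [Sfin|/existsNP[v Sv]] :=
    pselect (forall v, idsc_series m (line_restriction psi v) < +oo)%E.
  exact: haar_many_lines.
have {}Sv : idsc_series m (line_restriction psi v) = +oo%E.
  by apply/eqP; rewrite -leye_eq leNgt; exact/negP.
suff rv : line_rep v by exact: haar_one_line Sv.
(* Off the representatives all terms are 0 ^ m, which is 0 because m > 0, so the series cannot
   diverge. *)
apply: contraPT Sv => rv.
rewrite (_ : idsc_series _ _ = 0%E)//; apply: esum1 => d _.
by rewrite /line_restriction (negbTE rv) mulr0 mul0r expr0n gtn_eqF.
Qed.
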